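(* Let $\mathbb{F}=\mathbb{C}$ or $\mathbb{F}=\mathbb{R}$. (a) Let $f(x)=Ax+b$ and $g(x)=Cx+d$ be affine operators on $\mathbb{F}^n$ without fixed points. Let $A_*,C_*$ be nonsingular and $A_0,C_0$ nilpotent matrices over $\mathbb F$ such that $A$ is similar over $\mathbb F$ to $A_*\oplus A_0$ and $C$ is similar over $\mathbb F$ to $C_*\oplus C_0$. - If $\mathbb{F}=\mathbb{C}$, then $f$ and $g$ are topologically conjugate if and only if $A_0$ is similar to $C_0$. - If $\mathbb{F}=\mathbb{R}$, then $f$ and $g$ are topologically conjugate if and only if the determinants of $A_*$ and $C_*$ have the same sign (i.e., $\det(A_* )\det(C_* )>0$) and $A_0$ is similar to $C_0$. (b) Each affine operator $f:\mathbb{F}^n\to\mathbb{F}^n$ without fixed point is topologically conjugate to exactly one affine operator on $\mathbb{F}^n$ of the form $$x\mapsto (I_k\oplus J_0)x+[1,0,\dots,0]^T$$ or, only if $\mathbb{F}=\mathbb{R}$, $$x\mapsto (I_k\oplus[\,-1\,]\oplus J_0)x+[1,0,\dots,0]^T,$$ in which $k\geqslant 1$ and $J_0$ is a nilpotent Jordan matrix determined by $f$ uniquely up to permutation of blocks ($J_0$ is absent if $f$ is bijective). Here ''exactly one'' is understood up to permutation of the Jordan blocks of $J_0$.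
   Context: An affine operator on $\mathbb{F}^n$ is a map $f:\mathbb{F}^n\to\mathbb{F}^n$ of the form $f(x)=Ax+b$ with $A\in\mathbb{F}^{n\times n}$, $b\in\mathbb{F}^n$. A point $p$ is a fixed point of $f$ if $f(p)=p$. Two maps $f,g:\mathbb{F}^n\to\mathbb{F}^n$ are topologically conjugate if $g=h^{-1}fh$ (composition) for some homeomorphism $h:\mathbb{F}^n\to\mathbb{F}^n$ (with the usual topology; $h$ need not be linear). $I_k$ is the $k\times k$ identity matrix, $[\,-1\,]$ is the $1\times1$ matrix with entry $-1$, and $\oplus$ of matrices denotes the block diagonal direct sum. $J_m(0)$ is the $m\times m$ matrix with ones on the first subdiagonal and zeros elsewhere; a nilpotent Jordan matrix is a direct sum of matrices $J_{m}(0)$ (its blocks) of various sizes. Square matrices $M,N$ over $\mathbb F$ of the same size are similar if $S^{-1}MS=N$ for some nonsingular $S$ over $\mathbb F$; matrices of different sizes are not similar. Every square matrix $A$ over $\mathbb{F}$ is similar to $A_*\oplus A_0$ with $A_*$ nonsingular and $A_0$ nilpotent, unique up to similarity; either summand may be absent (of size $0\times 0$), two absent matrices being regarded as similar, and the determinant of an absent matrix being $1$. *)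

(* Defs.v *)
From mathcomp Require Import all_boot all_order all_algebra.
From mathcomp Require Import boolp classical_sets reals topology normedtype.

Set Implicit Arguments.
Unset Strict Implicit.
Unset Printing Implicit Defensive.

Import Order.TTheory GRing.Theory Num.Theory numFieldNormedType.Exports.

Local Open Scope ring_scope.

(* Everything is stated over a numFieldType F, to be instantiated by a realType
   R and by R[i]; the topology on F (and on 'cV[F]_n, the product topology) is
   the one induced by the norm of F, i.e., the usual one in both cases. *)

Definition affine (F : numFieldType) (n : nat) (A : 'M[F]_n) (b : 'cV[F]_n) :
  'cV[F]_n -> 'cV[F]_n := fun x => A *m x + b.

Definition fixed_point_free (T : Type) (f : T -> T) : Prop :=
  forall x, f x <> x.

Definition topologically_conjugate (F : numFieldType) (n : nat)
    (f g : 'cV[F]_n -> 'cV[F]_n) : Prop :=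
  exists h hinv : 'cV[F]_n -> 'cV[F]_n,
    [/\ cancel h hinv, cancel hinv h, continuous h, continuous hinv
      & g =1 hinv \o f \o h].

(* The two sizes are compared inside the definition, so that matrices of
   different sizes are never similar and all 0 x 0 matrices are.
   With P = S^-1, [similar_in unitmx A B] says that S^-1 A S = B for some
   nonsingular S. *)
Definition mx_similar (F : fieldType) (m n : nat) (A : 'M[F]_m) (B : 'M[F]_n) :
    Prop :=
  exists e : m = n, similar_in unitmx (castmx (e, e) A) B.

Definition mx_nilpotent (F : fieldType) (n : nat) (A : 'M[F]_n) : Prop :=
  exists k : nat, A ^+ k = 0.

Definition dsum_mx (F : fieldType) (m n : nat) (A : 'M[F]_m) (B : 'M[F]_n) :
  'M[F]_(m + n) := block_mx A 0 0 B.

Definition nilJordan_block (F : fieldType) (m : nat) : 'M[F]_m :=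
  \matrix_(i < m, j < m) (i == j.+1 :> nat)%:R.

(* s is the list of the sizes of the blocks *)
Fixpoint nilJordan_mx (F : fieldType) (s : seq nat) : 'M[F]_(sumn s) :=
  if s is m :: s' then dsum_mx (nilJordan_block F m) (nilJordan_mx F s') else 0.

(* The boolean e, read as 0 or 1, is the size of the scalar summand with
   diagonal entry -1, so the matrix is I_k (+) J_0 when e = false and
   I_k (+) [-1] (+) J_0 when e = true. *)
Definition canonical_mx (F : fieldType) (k : nat) (e : bool) (s : seq nat) :
  'M[F]_(k + (e + sumn s)) :=
  dsum_mx 1%:M (dsum_mx (-1)%:M (nilJordan_mx F s)).

Definition is_canonical (F : numFieldType) (n k : nat) (e : bool) (s : seq nat)
    (g : 'cV[F]_n -> 'cV[F]_n) : Prop :=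
  [/\ (0 < k)%N, all (leq 1) s
    & exists E : (k + (e + sumn s))%N = n,
        g =1 affine (castmx (E, E) (canonical_mx F k e s))
                    (\col_(i < n) (i == 0 :> nat)%:R)].

(* Main.v *)
Require Import Defs.
From mathcomp Require Import all_boot all_order all_algebra.
From mathcomp Require Import boolp classical_sets reals topology normedtype.
From mathcomp Require Import sequences.
From mathcomp Require Import complex.

(** Let [f] be an affine map [x |-> A x + b] without fixed points, and split [A]
    into a nonsingular part [As] and a nilpotent part [A0]. The classification
    says that the conjugacy class of [f] is determined by the size of [As], by
    the sign of its determinant over the reals, and by [A0] up to similarity.

    These data suffice. Since [b] is not in the image of [1 - A], some linear form
    is increased by one under [f] ([exists_raised_form]). The nilpotent part has a
    fixed point and splits off as a linear factor ([conjugate_split]); in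
    coordinates [(t, y)] where [t] is the raised form, the other factor is
    [(t, y) |-> (t + 1, B y + c t + d)]. For such maps the slab between the
    heights 0 and 1 is a fundamental domain, on which a conjugacy may be prescribed
    freely provided that it fits on the two faces ([glue]). Fitting means to join
    the quotient of two such maps to the identity by homeomorphisms preserving [t];
    the affine terms contract, and the linear parts can be joined whenever their
    quotient lies in the component of the identity of the linear group, that is,
    always over the complex numbers and when its determinant is positive over the
    reals ([isotopic_of_det], [conjugate_shift]).

    These data are invariants. The image of the [j]-th iterate of [f] is an affine
    subspace of dimension [\rank (A ^+ j)], so by invariance of dimension conjugate
    maps have equal ranks ([conjugate_rank]), and by the Jordan form these ranks
    determine the size of [As] and the similarity class of [A0]
    ([nilpotent_similar_of_rank]). A conjugacy maps the image of a high iterate to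
    its counterpart and so restricts to the nonsingular parts
    ([conjugate_bijective_part]). If their determinants had opposite signs, then by
    the first half of the argument a translation by some [a] would be conjugate by
    some [h] to a translation composed with a reflection. The map
    [v |-> h (t a + v) - h (t a - v)] would be odd, nonzero for [v != 0], and
    composed with a reflection when [t] increases by one
    ([no_reflecting_translation]).

    Invariance of dimension and the impossibility of the last situation are both
    instances of one theorem ([twisted_borsuk_ulam]): on the product of an interval
    with the unit sphere of an [n]-dimensional space, [n] real functions that are
    odd on the sphere have a common zero, provided that one takes opposite values
    at the two ends of the interval and the others take equal values. The proof is
    a computation modulo 2. If there is no common zero, then on every simplex of a
    fine triangulation some function keeps its sign, hence the cup product of the
    cochains that record the sign changes vanishes. But its sum over the product of
    the interval with a hemisphere is 1 ([twisted_cylinder_parity]): every cochain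
    is the coboundary of a sign, so the sum moves to the boundary, which is made of
    antipodal halves, where oddness removes one factor, and of the two ends, which
    cancel for the functions with equal end values. Fine triangulations come from
    the octahedral sphere by barycentric subdivision. *)

Set Implicit Arguments.
Unset Strict Implicit.
Unset Printing Implicit Defensive.

Import Order.TTheory GRing.Theory Num.Theory numFieldNormedType.Exports.

Local Open Scope ring_scope.

(** * Cochains modulo 2 on finite sequences of points *)

(** Chains are never formed: a chain is replaced by the functional that sums a
    cochain over its simplices, and a chain map by its transpose. Thus [cobd] is
    the transpose of the boundary map, augmented in that a single vertex has the
    empty face. *)
Fixpoint cobd (V : Type) (phi : seq V -> bool) (x : seq V) : bool :=
  if x is v :: s then phi s (+) cobd (fun y => phi (v :: y)) s else false.

Section Coboundary.
Variable V : eqType.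
Implicit Types (phi psi : seq V -> bool) (x y : seq V).

Lemma eq_cobd_face phi psi x :
    (forall y, size y = (size x).-1 -> {subset y <= x} -> phi y = psi y) ->
  cobd phi x = cobd psi x.
Proof.
elim: x phi psi => [//|v s IH] phi psi H /=; congr (_ (+) _).
  by apply: H => // z zs; rewrite inE zs orbT.
case: s IH H => [//|w s] IH H; apply: IH => y sy yw; apply: H; first by rewrite /= sy.
by move=> z; rewrite inE => /predU1P[->|/yw zw]; rewrite inE ?eqxx ?zw ?orbT.
Qed.

Lemma cobdD phi psi x :
  cobd (fun y => phi y (+) psi y) x = cobd phi x (+) cobd psi x.
Proof.
elim: x phi psi => //= v s IH phi psi; rewrite IH.
by case: (phi s); case: (psi s); case: cobd; case: cobd.
Qed.

Lemma cobd0 x : cobd (fun=> false) x = false.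
Proof. by elim: x => //= v s ->. Qed.

Lemma cobdK phi x : cobd (cobd phi) x = false.
Proof. by elim: x phi => //= v s IH phi; rewrite cobdD IH addbF addbb. Qed.

End Coboundary.

Lemma cobd_map (U V : Type) (f : U -> V) (phi : seq V -> bool) x :
  cobd phi (map f x) = cobd (fun y => phi (map f y)) x.
Proof. by elim: x phi => //= v s IH phi; rewrite IH. Qed.

Section Prism.
Variables (U V : eqType) (i0 i1 : U -> V).
Implicit Types (phi : seq V -> bool) (x : seq U).

(** The transpose of the prism operator, which sends [x] to the usual
    triangulation of the prism between [map i0 x] and [map i1 x]. *)
Fixpoint prism phi x : bool :=
  if x is v :: s
  then phi (i0 v :: map i1 x) (+) prism (fun y => phi (i0 v :: y)) s
  else false.

Lemma eq_prism phi psi x : (forall y, {subset y <= map i0 x ++ map i1 x} ->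
  (size y <= (size x).+1)%N -> phi y = psi y) -> prism phi x = prism psi x.
Proof.
elim: x phi psi => //= v s IH phi psi H; congr (_ (+) _).
  apply: H => [z|]; last by rewrite /= size_map.
  by rewrite !(inE, mem_cat) => /or3P[]->; rewrite /= ?orbT.
apply: IH => y ys sy; apply: H => // z.
rewrite inE => /predU1P[->|/ys]; first by rewrite inE eqxx.
by rewrite !(inE, mem_cat) => /orP[]->; rewrite /= ?orbT.
Qed.

Lemma prismD phi psi x :
  prism (fun y => phi y (+) psi y) x = prism phi x (+) prism psi x.
Proof.
elim: x phi psi => //= v s IH phi psi; rewrite IH.
by case: (phi _); case: (psi _); case: prism; case: prism.
Qed.

Lemma prism_cobd phi x :
  prism (cobd phi) x =
  cobd (prism phi) x (+) phi (map i1 x) (+) phi (map i0 x).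
Proof.
elim: x phi => [|v s IH] phi /=; first by rewrite addbb.
rewrite prismD IH cobdD !cobd_map.
set a := phi (i0 v :: _); set b' := phi (i1 v :: _).
set c := cobd _ s; set d := prism phi s; set e := cobd _ s.
by case: a; case: b'; case: c; case: d; case: e; case: (phi _).
Qed.

End Prism.

Lemma prism_map (U V : eqType) (i0 i1 : U -> V) (f : U -> U) (g : V -> V) phi x :
    (forall v, i0 (f v) = g (i0 v)) -> (forall v, i1 (f v) = g (i1 v)) ->
  prism i0 i1 phi (map f x) = prism i0 i1 (fun y => phi (map g y)) x.
Proof.
move=> H0 H1; elim: x phi => //= v s IH phi; rewrite IH !H0 H1 -!map_comp.
by rewrite (eq_map (g := g \o i1)).
Qed.

(** * Barycentric subdivision *)

Section Subdivision.
Variables (R : numFieldType) (V : normedModType R).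
Implicit Types (phi psi : seq V -> bool) (x y : seq V).

Definition mean x : V := (size x)%:R^-1 *: \sum_(v <- x) v.

(** The transpose of barycentric subdivision: a simplex is the cone from its
    barycentre over the subdivision of its boundary. The recursion is on the
    dimension, given as [n]. *)
Fixpoint sdn n phi x : bool :=
  if n is n'.+1 then
    if x is [::] then phi [::] else cobd (sdn n' (fun y => phi (mean x :: y))) x
  else phi x.

Definition sd phi x := sdn (size x) phi x.

Lemma sdE phi v s :
  sd phi (v :: s) = cobd (sd (fun y => phi (mean (v :: s) :: y))) (v :: s).
Proof.
rewrite -[LHS]/(cobd (sdn (size s) (fun y => phi (mean (v :: s) :: y))) (v :: s)).
by apply: eq_cobd_face => y /= sy _; rewrite /sd sy.
Qed.

Lemma sdD phi psi x : sd (fun y => phi y (+) psi y) x = sd phi x (+) sd psi x.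
Proof.
have [n] := ubnP (size x); elim: n x phi psi => // n IH [|v s] phi psi //= sn.
rewrite !sdE -cobdD; apply: eq_cobd_face => /= y sy _.
by apply: IH; rewrite sy.
Qed.

(** The boundary of a cone is its base plus the cone over the boundary of the
    base; the base is a boundary, so only the first term survives. *)
Lemma sd_cobd phi x : sd (cobd phi) x = cobd (sd phi) x.
Proof.
have [n] := ubnP (size x); elim: n x phi => // n IH [|v s] phi //= sn.
rewrite sdE -[RHS]/(cobd (sd phi) (v :: s)).
rewrite -[RHS]addbF -(cobdK (sd (fun y => phi (mean (v :: s) :: y))) (v :: s)).
rewrite -cobdD; apply: eq_cobd_face => /= y sy _.
by rewrite sdD IH ?sy.
Qed.

Lemma sd_map (f : V -> V) phi x :
    (forall y, y != [::] -> mean (map f y) = f (mean y)) ->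
  sd phi (map f x) = sd (fun y => phi (map f y)) x.
Proof.
move=> fM; have [n] := ubnP (size x); elim: n x phi => // n IH [|v s] phi //= sn.
rewrite !sdE -[f v :: _]/(map f (v :: s)) cobd_map fM //.
by apply: eq_cobd_face => /= y sy _; apply: IH; rewrite sy.
Qed.

Definition mean_closed (P : V -> Prop) :=
  forall x, x != [::] -> (forall v, v \in x -> P v) -> P (mean x).

Definition diam_le x (r : R) := forall v w, v \in x -> w \in x -> `|v - w| <= r.

(** The summand [v - v] of the average vanishes, so that only [(size x).-1] of
    the [size x] summands contribute. *)
Lemma mean_dist x r v : v \in x -> diam_le x r ->
  `|mean x - v| <= (size x).-1%:R / (size x)%:R * r.
Proof.
move=> vx xr; have sx : (size x)%:R != 0 :> R.
  by rewrite pnatr_eq0 size_eq0; case: x vx {xr}.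
have -> : mean x - v = (size x)%:R^-1 *: \sum_(w <- x) (w - v).
  rewrite sumrB scalerBr; congr (_ - _).
  rewrite big_const_seq count_predT iter_addr_0 -(scaler_nat _ v) scalerA.
  by rewrite mulVf // scale1r.
rewrite normrZ ger0_norm ?invr_ge0 ?ler0n // [_ / _]mulrC -mulrA.
rewrite ler_wpM2l ?invr_ge0 ?ler0n // (big_rem v) //= subrr add0r.
apply: le_trans (ler_norm_sum _ _ _) _.
rewrite mulr_natl -(size_rem vx) -iter_addr_0 -count_predT -big_const_seq.
rewrite big_seq [leRHS]big_seq; apply: ler_sum => w /mem_rem wx.
exact: xr.
Qed.

Lemma mean_closed_ball v r : 0 <= r -> mean_closed (fun w => `|v - w| <= r).
Proof.
move=> r0 x x0 H; have sx : (size x)%:R != 0 :> R by rewrite pnatr_eq0 size_eq0.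
have -> : v - mean x = (size x)%:R^-1 *: \sum_(w <- x) (v - w).
  rewrite sumrB scalerBr; congr (_ - _).
  rewrite big_const_seq count_predT iter_addr_0 -(scaler_nat _ v) scalerA.
  by rewrite mulVf // scale1r.
rewrite normrZ ger0_norm ?invr_ge0 ?ler0n // ler_pdivrMl; last first.
  by rewrite lt_def sx ler0n.
apply: le_trans (ler_norm_sum _ _ _) _.
rewrite mulr_natl -iter_addr_0 -count_predT -big_const_seq.
by rewrite big_seq [leRHS]big_seq; apply: ler_sum => w /H.
Qed.

(** All that is retained of a simplex [y] in a subdivision of [x]. Quantifying
    over the sets closed under averages expresses that [y] lies in the convex
    hull of [x]. *)
Definition fine (q : R) x y : Prop :=
  [/\ size y = size x,
      forall P, mean_closed P -> (forall v, v \in x -> P v) ->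
        forall v, v \in y -> P v
    & forall r, 0 <= r -> diam_le x r -> diam_le y (q * r)].

(** The ball about the barycentre that contains the vertices of [x] is convex, so
    that it contains the subdivision of the faces as well: this bounds the edges
    at the barycentre, and induction bounds the others. *)
Lemma eq_sd_fine N phi psi x : (size x <= N.+1)%N ->
    (forall y, fine (N%:R / N.+1%:R) x y -> phi y = psi y) ->
  sd phi x = sd psi x.
Proof.
set q : R := _ / _; have q0 : 0 <= q by rewrite divr_ge0 ?ler0n.
have [n] := ubnP (size x); elim: n x phi psi => // n IH [|v s] phi psi sn sN H.
  by apply: H; split.
rewrite !sdE; apply: eq_cobd_face => y /= sy yx.
apply: IH => [||z [sz Pz dz]]; first by rewrite sy.
  by rewrite sy ltnW.
set x := v :: s in H sN sn yx *.
apply: H; split=> [|P Pm Px w|r r0 xr].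
- by rewrite /= sz sy.
- by rewrite inE => /predU1P[->|]; [exact: Pm|apply: Pz => // u /yx /Px].
have zb w : w \in z -> `|mean x - w| <= q * r.
  apply: (Pz (fun w => `|mean x - w| <= q * r)).
    by apply: mean_closed_ball; rewrite mulr_ge0.
  move=> u /yx ux; apply: le_trans (mean_dist ux xr) _.
  rewrite ler_wpM2r // ler_pdivrMr ?ltr0n // mulrAC ler_pdivlMr ?ltr0n //.
  rewrite -!natrM ler_nat /=.
  rewrite /= ltnS in sN; rewrite mulnS [leqRHS]mulnS addnC [leqRHS]addnC mulnC.
  by rewrite leq_add2l.
move=> u w; rewrite !inE => /predU1P[->|uz] /predU1P[->|wz].
- by rewrite subrr normr0 mulr_ge0.
- exact: zb.
- by rewrite distrC zb.
- by apply: dz => // a b /yx ax /yx bx; apply: xr.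
Qed.

Lemma iter_sdD m phi psi x :
  iter m sd (fun y => phi y (+) psi y) x = iter m sd phi x (+) iter m sd psi x.
Proof.
elim: m x => //= m IH x; rewrite -sdD.
by congr (sd _ x); apply: funext => y; apply: IH.
Qed.

Lemma iter_sd_cobd m phi : iter m sd (cobd phi) = cobd (iter m sd phi).
Proof. by elim: m => //= m ->; apply: funext => x; rewrite sd_cobd. Qed.

Lemma iter_sd_map m (f : V -> V) phi x :
    (forall y, y != [::] -> mean (map f y) = f (mean y)) ->
  iter m sd phi (map f x) = iter m sd (fun y => phi (map f y)) x.
Proof.
move=> fM; elim: m x => //= m IH x.
by rewrite sd_map //; congr (sd _ x); apply: funext => y; rewrite IH.
Qed.

Lemma eq_iter_sd_fine N m phi psi x : (size x <= N.+1)%N ->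
    (forall y, fine ((N%:R / N.+1%:R) ^+ m) x y -> phi y = psi y) ->
  iter m sd phi x = iter m sd psi x.
Proof.
elim: m x => [|m IH] x sN H /=; first by apply: H; split=> // r; rewrite mul1r.
apply: (eq_sd_fine sN) => y [sy Py dy].
apply: IH => [|z [sz Pz dz]]; first by rewrite sy.
apply: H; split=> [|P Pm Px|r r0 xr].
- by rewrite sz.
- by apply: Pz => // v; apply: Py.
- rewrite exprSr -mulrA; apply: dz; last exact: dy.
  by rewrite mulr_ge0 // divr_ge0 ?ler0n.
Qed.

Lemma iter_sd_point m phi v : iter m sd phi [:: v] = phi [:: v].
Proof.
elim: m => //= m <-; rewrite sdE /= addbF; congr (iter _ _ _ [:: _]).
by rewrite /mean /= big_seq1 invr1 scale1r.
Qed.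

End Subdivision.

(** * Cup products of sign changes *)

Section Cup.
Variables (V I : eqType) (sg : I -> V -> bool).
Implicit Types (i j : I) (ii : seq I) (x y : seq V).

Definition weight i (phi : seq V -> bool) x : bool :=
  if x is v :: _ then sg i v && phi x else false.

(** The cup product of the cochains [sg i v (+) sg i w]. Each of them is the
    coboundary of [sg i], hence so is their product, up to a weight; this form
    makes the cocycle property immediate, and [cup_cons] gives back the product. *)
Fixpoint cup ii : seq V -> bool :=
  if ii is i :: ii' then cobd (weight i (cup ii')) else fun x => size x == 1%N.

Lemma cup_nil ii : cup ii [::] = false.
Proof. by case: ii. Qed.

Lemma cobd_cup ii x : cobd (cup ii) x = false.
Proof.
case: ii => [|i ii]; last exact: cobdK.
case: x => [|v [|w [|z x]]] //.
by rewrite -(cobd0 [:: v, w, z & x]); apply: eq_cobd_face => y /= ->.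
Qed.

Lemma cobd_cup_cons ii v x : cobd (fun y => cup ii (v :: y)) x = cup ii x.
Proof. by move: (cobd_cup ii (v :: x)) => /= /negbT; rewrite negb_add => /eqP. Qed.

Lemma cup_cons i ii v x :
  cup (i :: ii) (v :: x) =
  if x is w :: _ then (sg i v (+) sg i w) && cup ii x else false.
Proof.
have cobdZ b phi y : cobd (fun z : seq V => b && phi z) y = b && cobd phi y.
  by case: b => //=; rewrite cobd0.
rewrite /= (cobdZ (sg i v) (fun y => cup ii (v :: y))) cobd_cup_cons.
case: x => [|w x] /=; first by rewrite cup_nil andbF.
by case: (sg i v); case: (sg i w); case: (cup _ _).
Qed.

(** This is how common zeros are detected: where there is none, some sign is
    constant on every small simplex. *)
Lemma cup_const i ii x : {in x &, forall v w, sg i v = sg i w} -> i \in ii ->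
  cup ii x = false.
Proof.
elim: ii x => //= j ii IH [//|v [|w x]] // H.
rewrite -[cobd _ _]/(cup (j :: ii) _) cup_cons inE => /predU1P[<-|iii].
  by rewrite (H v w) ?inE ?eqxx ?orbT // addbb.
rewrite IH ?andbF // => a b ax bx.
by apply: H; rewrite inE ?ax ?bx orbT.
Qed.

Lemma cup_map (f : V -> V) ii x :
    (forall i, i \in ii ->
      {in x &, forall v w, sg i (f v) (+) sg i (f w) = sg i v (+) sg i w}) ->
  cup ii (map f x) = cup ii x.
Proof.
elim: ii x => [|i ii IH] x H; first by rewrite /= size_map.
case: x H => [|v [|w x]] // H.
rewrite -[map _ _]/(f v :: f w :: map f x) !cup_cons.
rewrite H ?inE ?eqxx ?orbT //=.
rewrite -[f w :: _]/(map f (w :: x)) IH // => j jii a b ax bx.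
by apply: H; rewrite inE ?jii ?ax ?bx orbT.
Qed.

End Cup.

(** * The octahedral chains *)

Section Octahedron.
Variables (V : eqType) (e : nat -> V) (tau : V -> V).
Hypothesis tauK : involutive tau.
Implicit Types (psi : seq V -> bool).

(** [sphere j] sums over the facets of the octahedral (j - 1)-sphere with
    vertices [e i] and [tau (e i)], and [hemisphere j] over those of the
    j-dimensional hemisphere that contain [e j]. *)
Fixpoint sphere j psi : bool :=
  if j is j'.+1 then
    sphere j' (fun y => psi (e j' :: y))
      (+) sphere j' (fun y => psi (tau (e j') :: y))
  else psi [::].

Definition hemisphere j psi := sphere j (fun y => psi (e j :: y)).

Fixpoint octant (eps : nat -> bool) j : seq V :=
  if j is j'.+1
  then (if eps j' then e j' else tau (e j')) :: octant eps j' else [::].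

Lemma size_octant eps j : size (octant eps j) = j.
Proof. by elim: j => //= j ->. Qed.

Lemma mem_octant eps j v : v \in octant eps j ->
  exists2 i, (i < j)%N & v = if eps i then e i else tau (e i).
Proof.
elim: j => //= j IH; rewrite inE => /predU1P[->|/IH[i ij ->]]; first by exists j.
by exists i; rewrite // ltnW.
Qed.

Lemma eq_octant eps eps' j : (forall i, (i < j)%N -> eps i = eps' i) ->
  octant eps j = octant eps' j.
Proof.
by elim: j => //= j IH H; rewrite H // IH // => i ij; apply: H; rewrite ltnW.
Qed.

Lemma eq_sphere j psi psi' :
    (forall eps, psi (octant eps j) = psi' (octant eps j)) ->
  sphere j psi = sphere j psi'.
Proof.
elim: j psi psi' => [|j IH] psi psi' H /=; first exact: (H xpredT).
by congr (_ (+) _); apply: IH => eps;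
  [have := H (fun i => if i == j then true else eps i)
  |have := H (fun i => if i == j then false else eps i)];
  rewrite /= eqxx (@eq_octant _ eps) // => i ij; rewrite ltn_eqF.
Qed.

Lemma eq_hemisphere j psi psi' :
    (forall eps, psi (octant eps j.+1) = psi' (octant eps j.+1)) ->
  hemisphere j psi = hemisphere j psi'.
Proof.
move=> H; apply: eq_sphere => eps; have := H (fun i => if i == j then true else eps i).
by rewrite /= eqxx (@eq_octant _ eps) // => i ij; rewrite ltn_eqF.
Qed.

Lemma sphereD j psi psi' :
  sphere j (fun y => psi y (+) psi' y) = sphere j psi (+) sphere j psi'.
Proof.
elim: j psi psi' => //= j IH psi psi'; rewrite !IH.
by case: sphere; case: sphere; case: sphere; case: sphere.
Qed.

Lemma hemisphereD j psi psi' :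
  hemisphere j (fun y => psi y (+) psi' y) =
  hemisphere j psi (+) hemisphere j psi'.
Proof. exact: sphereD. Qed.

Lemma sphere_cobd j psi : sphere j (cobd psi) = false.
Proof. by elim: j psi => //= j IH psi; rewrite !sphereD !IH !addbF addbb. Qed.

Lemma sphere_tau j psi : sphere j (fun y => psi (map tau y)) = sphere j psi.
Proof.
elim: j psi => //= j IH psi; rewrite addbC tauK.
by rewrite (IH (fun y => psi (_ :: y))) (IH (fun y => psi (tau _ :: y))).
Qed.

Lemma hemisphere_cobd0 psi : hemisphere 0 (cobd psi) = psi [::].
Proof. by rewrite /hemisphere /= addbF. Qed.

(** The boundary of a hemisphere is the sphere below it, which consists of a
    smaller hemisphere and its antipode. *)
Lemma hemisphere_cobd j psi :
  hemisphere j.+1 (cobd psi) =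
  hemisphere j psi (+) hemisphere j (fun y => psi (map tau y)).
Proof.
rewrite /hemisphere -[LHS]/(sphere j.+1 (fun y => psi y (+) cobd (fun z => psi (e j.+1 :: z)) y)).
rewrite sphereD sphere_cobd addbF /=; congr (_ (+) _).
by rewrite -[LHS]sphere_tau.
Qed.

End Octahedron.

(** * Parity of sign changes on the cylinder over a sphere *)

Section Cylinder.
Variables (R : realType) (n : nat).
Local Notation V := 'rV[R]_(1 + n).
Implicit Types (z : V) (x y : seq V) (phi psi : seq V -> bool).

Definition height z : R := z 0 (lshift n 0).
Definition coef z (i : 'I_n) : R := z 0 (rshift 1 i).
Definition antipode z : V := row_mx (lsubmx z) (- rsubmx z).
Definition lift1 z : V := z + row_mx (const_mx 1) 0.
Definition axis (i : nat) : V := row_mx 0 (\row_j (j == i :> nat)%:R).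

(** The product of the unit interval with the unit sphere of the 1-norm, on which
    the octahedral triangulation is made of affine simplices. *)
Definition on_cylinder z := 0 <= height z <= 1 /\ \sum_i `|coef z i| = 1.

Lemma height_antipode z : height (antipode z) = height z.
Proof. by rewrite /height row_mxEl mxE. Qed.
Lemma height_lift1 z : height (lift1 z) = height z + 1.
Proof. by rewrite /height mxE row_mxEl mxE. Qed.
Lemma coef_antipode z i : coef (antipode z) i = - coef z i.
Proof. by rewrite /coef row_mxEr !mxE. Qed.
Lemma coef_lift1 z i : coef (lift1 z) i = coef z i.
Proof. by rewrite /coef mxE row_mxEr mxE addr0. Qed.
Lemma coef_axis (j : nat) i : coef (axis j) i = (i == j :> nat)%:R.
Proof. by rewrite /coef row_mxEr mxE. Qed.
Lemma height_axis j : height (axis j) = 0.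
Proof. by rewrite /height row_mxEl mxE. Qed.

Lemma antipodeK : involutive antipode.
Proof.
move=> z; rewrite /antipode row_mxKl row_mxKr opprK.
exact: (hsubmxK z).
Qed.

Lemma antipode_lift1 z : antipode (lift1 z) = lift1 (antipode z).
Proof.
apply/rowP => i; rewrite /antipode /lift1.
by case: (split_ordP i) => j ->;
  rewrite !(row_mxEl, row_mxEr, mxE) ?row_mxEl ?row_mxEr ?mxE ?addr0.
Qed.

Lemma mean_entry x i j :
  mean x i j = (size x)%:R^-1 * \sum_(v <- x) v i j.
Proof. by rewrite mxE summxE. Qed.

Lemma mean_antipode x : x != [::] -> mean (map antipode x) = antipode (mean x).
Proof.
move=> _; apply/rowP => i; rewrite mean_entry /antipode big_map size_map.
case: (split_ordP i) => j ->; rewrite ?row_mxEl ?row_mxEr !mxE ?summxE.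
  by congr (_ * _); apply: eq_bigr => v _; rewrite row_mxEl mxE.
rewrite -mulrN; congr (_ * _); rewrite -sumrN.
by apply: eq_bigr => v _; rewrite row_mxEr !mxE.
Qed.

Lemma mean_lift1 x : x != [::] -> mean (map lift1 x) = lift1 (mean x).
Proof.
move=> x0; rewrite /mean size_map big_map big_split /= scalerDr.
congr (_ + _); rewrite big_const_seq count_predT iter_addr_0.
rewrite -[in LHS](scaler_nat _ (row_mx _ _)) scalerA mulVf ?scale1r //.
by rewrite pnatr_eq0 size_eq0.
Qed.

Lemma mean_closed_ge (l : V -> R) (a : R) :
    (forall x, l (mean x) = (size x)%:R^-1 * \sum_(v <- x) l v) ->
  mean_closed (fun z => a <= l z).
Proof.
move=> lin x x0 H; have sx : (size x)%:R != 0 :> R by rewrite pnatr_eq0 size_eq0.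
rewrite lin ler_pdivlMl; last by rewrite lt_def sx ler0n.
rewrite mulr_natl -iter_addr_0 -count_predT -big_const_seq.
by rewrite big_seq [leRHS]big_seq; apply: ler_sum => v; apply: H.
Qed.

Lemma mean_closedI (P Q : V -> Prop) :
  mean_closed P -> mean_closed Q -> mean_closed (fun z => P z /\ Q z).
Proof. by move=> PM QM x x0 H; split; [apply: PM|apply: QM] => // v /H[]. Qed.

Lemma mean_closed_eq (l : V -> R) (a : R) :
    (forall x, l (mean x) = (size x)%:R^-1 * \sum_(v <- x) l v) ->
  mean_closed (fun z => l z = a).
Proof.
move=> lin x x0 H; have sx : (size x)%:R != 0 :> R by rewrite pnatr_eq0 size_eq0.
rewrite lin big_seq (eq_bigr (fun=> a)) //.
rewrite -big_seq big_const_seq count_predT iter_addr_0 -(mulr_natl a).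
by rewrite mulrA mulVf ?mul1r.
Qed.

Lemma mean_height x : height (mean x) = (size x)%:R^-1 * \sum_(v <- x) height v.
Proof. exact: mean_entry. Qed.

(** The part of the cylinder above the closed orthant of signs [eps]: a convex
    set, unlike the whole cylinder. *)
Definition sector (eps : nat -> bool) z :=
  (0 <= height z /\ -1 <= - height z) /\
  ((forall i : 'I_n, 0 <= (-1) ^+ (~~ eps i) * coef z i) /\
   \sum_(i < n) (-1) ^+ (~~ eps i) * coef z i = 1).

Lemma mean_closed_sector eps : mean_closed (sector eps).
Proof.
apply: mean_closedI; apply: mean_closedI.
- exact/mean_closed_ge/mean_height.
- apply: (@mean_closed_ge (fun z => - height z)) => x.
  by rewrite mean_height -mulrN -sumrN.
- move=> x x0 H i.
  apply: (@mean_closed_ge (fun z => (-1) ^+ (~~ eps i) * coef z i)) => // [y|v /H //].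
  by rewrite /coef mean_entry mulrCA mulr_sumr.
- apply: mean_closed_eq => x; rewrite exchange_big mulr_sumr.
  by apply: eq_bigr => i _; rewrite /coef mean_entry mulrCA mulr_sumr.
Qed.

Lemma sector_on_cylinder eps z : sector eps z -> on_cylinder z.
Proof.
case=> [[h0 h1] [c0 c1]]; rewrite lerN2 in h1; split; first by rewrite h0 h1.
rewrite -[RHS]c1; apply: eq_bigr => i _.
by rewrite -[RHS]ger0_norm // normrM normr_sign mul1r.
Qed.

Lemma on_cylinder_bound z : on_cylinder z -> `|z| <= 1.
Proof.
case=> [/andP[h0 h1] c1]; rewrite [leLHS]/Num.norm /= mx_normrE.
apply/bigmax_leP; split=> // -[i j] _ /=; rewrite ord1.
case: (split_ordP j) => l ->; first by rewrite ord1 ger0_norm.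
by rewrite -c1 (bigD1 l) //= lerDl; apply: sumr_ge0.
Qed.

Lemma on_cylinder_dist z z' : on_cylinder z -> on_cylinder z' -> `|z - z'| <= 2.
Proof.
move=> zc zc'; rewrite (le_trans (ler_normB _ _)) // -[2]/(1 + 1) lerD //;
exact: on_cylinder_bound.
Qed.

Lemma sector_vertex eps (i : nat) : (i < n)%N ->
  sector eps (if eps i then axis i else antipode (axis i)).
Proof.
move=> ni; have cE (j : 'I_n) : (-1) ^+ (~~ eps j) *
    coef (if eps i then axis i else antipode (axis i)) j = (j == i :> nat)%:R.
  case: (eqVneq (j : nat) i) => ji.
    by rewrite -ji; case: (eps j); rewrite ?coef_antipode coef_axis ji eqxx ?mulrNN mulr1.
  by case: (eps i); rewrite ?coef_antipode coef_axis (negPf ji) ?oppr0 mulr0.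
split.
  have -> : height (if eps i then axis i else antipode (axis i)) = 0.
    by case: (eps i); rewrite ?height_antipode height_axis.
  by rewrite oppr0 lexx lerN10.
split=> [j|]; first by rewrite cE ler0n.
rewrite (eq_bigr (fun j : 'I_n => (j == i :> nat)%:R)) //.
rewrite (bigD1 (Ordinal ni)) //= eqxx big1 ?addr0 // => j ji.
by rewrite (negPf (_ : (j != i :> nat))).
Qed.

Lemma sector_lift1 eps z : sector eps z -> height z = 0 -> sector eps (lift1 z).
Proof.
case=> [_ [c0 c1]] hz; split; first by rewrite height_lift1 hz add0r ler01 lexx.
split=> [i|]; first by rewrite coef_lift1.
by rewrite -[RHS]c1; apply: eq_bigr => i _; rewrite coef_lift1.
Qed.

Variable m : nat.

(** The sums of [phi] over the [m]-th subdivisions of the [k]-dimensional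
    hemisphere at height zero and of the cylinder over it. *)
Definition fine_sphere k phi := hemisphere axis antipode k (iter m (@sd R V) phi).

Definition fine_cylinder k phi :=
  hemisphere axis antipode k (prism id lift1 (iter m (@sd R V) phi)).

Lemma octant_sector eps k z : (k <= n)%N ->
  z \in octant axis antipode eps k -> sector eps z /\ height z = 0.
Proof.
move=> kn /mem_octant[i ik ->]; split.
  by apply: sector_vertex; apply: leq_trans kn.
by case: (eps i); rewrite ?height_antipode height_axis.
Qed.

Lemma eq_fine_sphere k phi psi : (k < n)%N ->
    (forall y, (forall z, z \in y -> on_cylinder z /\ height z = 0) ->
       phi y = psi y) ->
  fine_sphere k phi = fine_sphere k psi.
Proof.
move=> kn H; apply: eq_hemisphere => eps.
apply: (@eq_iter_sd_fine _ _ n); first by rewrite size_octant ltnS ltnW.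
move=> y [_ yP _]; apply: H => z zy.
have [||sz hz] := yP (fun z => sector eps z /\ height z = 0) _ _ z zy.
- apply: mean_closedI; first exact: mean_closed_sector.
  exact/mean_closed_eq/mean_height.
- by move=> v; apply: octant_sector.
- by split=> //; apply: sector_on_cylinder sz.
Qed.

Lemma eq_fine_cylinder k phi psi : (k < n)%N ->
    (forall y, (forall z, z \in y -> on_cylinder z) ->
       diam_le y ((n%:R / n.+1%:R) ^+ m * 2) -> phi y = psi y) ->
  fine_cylinder k phi = fine_cylinder k psi.
Proof.
move=> kn H; apply: eq_hemisphere => eps; apply: eq_prism => x.
rewrite map_id size_octant => xs sx.
have xsec v : v \in x -> sector eps v.
  move=> /xs; rewrite mem_cat => /orP[/octant_sector[]//|/mapP[w]].
  by move=> /octant_sector[]// ws wh ->; apply: sector_lift1.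
apply: (@eq_iter_sd_fine _ _ n); first exact: leq_trans sx _.
move=> y [_ yP yd]; apply: H => [z zy|].
  by apply: (@sector_on_cylinder eps); apply: yP zy => //; apply: mean_closed_sector.
apply: yd => // v w vx wx.
by apply: on_cylinder_dist; apply: (@sector_on_cylinder eps); apply: xsec.
Qed.

Lemma fine_sphereD k phi psi :
  fine_sphere k (fun y => phi y (+) psi y) =
  fine_sphere k phi (+) fine_sphere k psi.
Proof.
rewrite -hemisphereD; apply: eq_hemisphere => eps; exact: iter_sdD.
Qed.

Lemma fine_cylinderD k phi psi :
  fine_cylinder k (fun y => phi y (+) psi y) =
  fine_cylinder k phi (+) fine_cylinder k psi.
Proof.
rewrite -hemisphereD; apply: eq_hemisphere => eps; rewrite -prismD.
by congr prism; apply: funext => y; apply: iter_sdD.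
Qed.

Lemma fine_sphere_cobd k phi :
  fine_sphere k.+1 (cobd phi) =
  fine_sphere k (fun y => phi y (+) phi (map antipode y)).
Proof.
rewrite fine_sphereD /fine_sphere iter_sd_cobd (hemisphere_cobd _ antipodeK).
congr (_ (+) _); apply: eq_hemisphere => eps.
by rewrite iter_sd_map //; apply: mean_antipode.
Qed.

Lemma fine_sphere0 phi : fine_sphere 0 phi = phi [:: axis 0].
Proof. exact: iter_sd_point. Qed.

Lemma fine_cylinder_cobd_end k phi : 
  fine_cylinder k (cobd phi) =
  hemisphere axis antipode k (cobd (prism id lift1 (iter m (@sd R V) phi)))
  (+) fine_sphere k (fun y => phi (map lift1 y) (+) phi y).
Proof.
rewrite fine_sphereD /fine_sphere -!hemisphereD; apply: eq_hemisphere => eps.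
rewrite iter_sd_cobd prism_cobd map_id (iter_sd_map _ _ _ mean_lift1) addbA.
by [].
Qed.

Lemma fine_cylinder_cobd0 phi :
  fine_cylinder 0 (cobd phi) =
  fine_sphere 0 (fun y => phi (map lift1 y) (+) phi y).
Proof. by rewrite fine_cylinder_cobd_end hemisphere_cobd0. Qed.

Lemma fine_cylinder_cobd k phi :
  fine_cylinder k.+1 (cobd phi) =
  fine_cylinder k (fun y => phi y (+) phi (map antipode y))
  (+) fine_sphere k.+1 (fun y => phi (map lift1 y) (+) phi y).
Proof.
rewrite fine_cylinder_cobd_end; congr (_ (+) _).
rewrite (hemisphere_cobd _ antipodeK) fine_cylinderD; congr (_ (+) _).
apply: eq_hemisphere => eps.
rewrite (prism_map (g := antipode)) //; last by move=> v; rewrite antipode_lift1.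
congr prism; apply: funext => y.
by rewrite iter_sd_map //; apply: mean_antipode.
Qed.

Section Parity.
Variables (I : eqType) (sg : I -> V -> bool).

Definition odd_sign i :=
  forall z, on_cylinder z -> sg i (antipode z) = ~~ sg i z.

Definition periodic_sign i := forall z, sg i (lift1 z) = sg i z.

Definition twisted_sign i :=
  forall z, height z = 0 -> sg i (lift1 z) = ~~ sg i z.

(** Exactly one of [y] and its antipode has sign [true] at its first vertex, and
    sign changes are the same on both. *)
Lemma weight_antipode i ii y : {in i :: ii, forall j, odd_sign j} ->
    (forall z, z \in y -> on_cylinder z) ->
  weight sg i (cup sg ii) y (+) weight sg i (cup sg ii) (map antipode y) =
  cup sg ii y.
Proof.
move=> odd yc; case: y yc => [|v y] yc; first by rewrite cup_nil.
rewrite [LHS]/= -[antipode v :: _]/(map antipode (v :: y)) cup_map.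
  rewrite odd ?inE ?eqxx //; last by apply: yc; rewrite inE eqxx.
  by case: (sg i v); rewrite ?addbF.
move=> j jii a b ay by'; rewrite !odd ?inE ?jii ?orbT //; try exact: yc.
by rewrite addbN addNb negbK.
Qed.

(** A form of the Borsuk-Ulam theorem. The cup product is the coboundary of a
    weighted cup product, whose values on the two halves of the boundary sphere
    add up to the cup product of the remaining signs. *)
Lemma sphere_parity ii : {in ii, forall i, odd_sign i} -> (size ii < n)%N ->
  fine_sphere (size ii) (cup sg ii) = true.
Proof.
elim: ii => [_ _|i ii IH odd sn]; first by rewrite fine_sphere0.
rewrite -[RHS](IH _ (ltnW sn)); last by move=> j jii; apply: odd; rewrite inE jii orbT.
rewrite -[LHS]/(fine_sphere (size ii).+1 (cobd (weight sg i (cup sg ii)))).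
rewrite fine_sphere_cobd; apply: eq_fine_sphere; first exact: ltnW.
by move=> y yc; apply: weight_antipode => // z /yc[].
Qed.

Lemma fine_sphere_false k phi : (k < n)%N ->
    (forall y, (forall z, z \in y -> on_cylinder z /\ height z = 0) ->
       phi y = false) ->
  fine_sphere k phi = false.
Proof.
move=> kn H; rewrite (eq_fine_sphere (psi := fun y => false (+) false)) //.
by rewrite fine_sphereD addbb.
Qed.

Lemma fine_cylinder_false k phi : (k < n)%N ->
    (forall y, (forall z, z \in y -> on_cylinder z) ->
       diam_le y ((n%:R / n.+1%:R) ^+ m * 2) -> phi y = false) ->
  fine_cylinder k phi = false.
Proof.
move=> kn H; rewrite (eq_fine_cylinder (psi := fun y => false (+) false)) //.
by rewrite fine_cylinderD addbb.
Qed.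

(** The same descent on the cylinder, whose boundary also includes the two ends;
    these cancel since the signs are periodic. *)
Lemma periodic_cylinder_parity ii :
    {in ii, forall i, odd_sign i /\ periodic_sign i} -> (0 < size ii <= n)%N ->
  fine_cylinder (size ii).-1 (cup sg ii) = false.
Proof.
elim: ii => // i ii IH H /= sn.
have top : fine_sphere (size ii)
    (fun y => weight sg i (cup sg ii) (map lift1 y) (+) weight sg i (cup sg ii) y)
    = false.
  apply: fine_sphere_false => // -[|v y] _ //=.
  rewrite -[lift1 v :: _]/(map lift1 (v :: y)) cup_map.
    by have [_ ->] := H i (mem_head _ _); rewrite addbb.
  by move=> j jii a b _ _; have [|_ P] := H j; rewrite ?inE ?jii ?orbT // !P.
case: ii => [|j ii] in IH H sn top *; first by rewrite fine_cylinder_cobd0.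
rewrite fine_cylinder_cobd top addbF.
rewrite -[RHS](IH _ (ltnW sn)); last by move=> l lii; apply: H; rewrite inE lii orbT.
apply: eq_fine_cylinder; first exact: ltnW.
by move=> y yc _; apply: weight_antipode => // l /H[].
Qed.

(** The sign [u] makes the contributions of the two ends add up to the cup
    product of the other signs on a sphere, which is odd, while the lateral
    contribution is even. *)
Lemma twisted_cylinder_parity u ii :
    odd_sign u -> twisted_sign u ->
    {in ii, forall i, odd_sign i /\ periodic_sign i} -> (size ii < n)%N ->
  fine_cylinder (size ii) (cup sg (u :: ii)) = true.
Proof.
move=> uo ut H sn.
have top : fine_sphere (size ii)
    (fun y => weight sg u (cup sg ii) (map lift1 y) (+) weight sg u (cup sg ii) y)
    = true.
  rewrite -[RHS](sphere_parity (ii := ii)) //; last by move=> i /H[].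
  apply: eq_fine_sphere => // -[|v y] yc; first by rewrite /= cup_nil.
  rewrite [LHS]/= -[lift1 v :: _]/(map lift1 (v :: y)) cup_map.
    rewrite ut; last by have [] := yc v (mem_head _ _).
    by case: (sg u v); rewrite ?addbF.
  by move=> j /H[_ P] a b _ _; rewrite !P.
rewrite -[cup _ (u :: _)]/(cobd (weight sg u (cup sg ii))).
case: ii => [|j ii] in H sn top *; first by rewrite fine_cylinder_cobd0.
rewrite fine_cylinder_cobd top addbT; apply/negPf.
rewrite -[RHS](@periodic_cylinder_parity (j :: ii)) //; last exact: ltnW.
apply: eq_fine_cylinder; first exact: ltnW.
move=> y yc _; apply: weight_antipode => // l; rewrite inE => /predU1P[->//|/H[]//].
Qed.

(** The nonzero parity forces the cup product to be nonzero on some simplex. *)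
Lemma exists_alternating u ii :
    odd_sign u -> twisted_sign u ->
    {in ii, forall i, odd_sign i /\ periodic_sign i} -> (size ii < n)%N ->
  exists y, [/\ forall z, z \in y -> on_cylinder z,
    diam_le y ((n%:R / n.+1%:R) ^+ m * 2)
    & forall i, i \in u :: ii -> ~ {in y &, forall v w, sg i v = sg i w}].
Proof.
move=> uo ut H sn; have := twisted_cylinder_parity uo ut H sn.
apply: contraPP => N; rewrite fine_cylinder_false // => y yc yd.
apply/negbTE/negP => cy; apply: N; exists y; split=> // i iii const.
by move: cy; rewrite (cup_const const).
Qed.

End Parity.

End Cylinder.

(** * The twisted Borsuk-Ulam theorem *)

Lemma continuous_sum (K : numFieldType) (T : topologicalType) (I : Type)
    (r : seq I) (F : I -> T -> K) :
  (forall i, continuous (F i)) -> continuous (fun x => \sum_(i <- r) F i x).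
Proof. by move=> Fc; apply: continuous_big => //; apply: add_continuous. Qed.

Section BorsukUlam.
Variables (R : realType) (n : nat).
Local Notation V := 'rV[R]_(1 + n).

Lemma continuous_coef (i : 'I_n) : continuous (fun z : V => coef z i).
Proof. exact: coord_continuous. Qed.

Lemma continuous_height : continuous (@height R n).
Proof. exact: coord_continuous. Qed.

Lemma compact_cylinder : compact (@on_cylinder R n).
Proof.
apply: bounded_closed_compact.
  exists 1; split=> // M M1 z /on_cylinder_bound z1; exact: le_trans z1 (ltW M1).
have -> : @on_cylinder R n = ((@height R n) @^-1` `[0, 1] `&`
    (fun z : V => \sum_i `|coef z i|) @^-1` [set 1])%classic.
  by apply/seteqP; split=> z /=; rewrite in_itv /=.
apply: closedI.
  by move/continuous_closedP: continuous_height; apply; exact: itv_closed.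
suff /continuous_closedP : continuous (fun z : V => \sum_i `|coef z i|).
  by apply; exact: closed_eq.
apply: continuous_sum => i z.
by apply: continuous_comp; [exact: continuous_coef|exact: norm_continuous].
Qed.

(** The sign of the first nonzero coefficient. It replaces the sign of a function
    at the zeros of the latter, so that signs are odd on the whole cylinder. *)
Definition tie (z : V) : bool :=
  if [pick i | coef z i != 0] is Some i then 0 < coef z i else false.

Lemma tie_antipode z : on_cylinder z -> tie (antipode z) = ~~ tie z.
Proof.
case=> _ c1; rewrite /tie (eq_pick (Q := fun i => coef z i != 0)); last first.
  by move=> i; rewrite coef_antipode oppr_eq0.
case: pickP => [i ci|c0].
  by rewrite coef_antipode oppr_gt0 lt_neqAle ci /= leNgt.
move: c1; rewrite big1 => [/esym/eqP|i _]; first by rewrite oner_eq0.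
by move/negbFE/eqP: (c0 i) => ->; rewrite normr0.
Qed.

Lemma tie_lift1 z : tie (lift1 z) = tie z.
Proof.
rewrite /tie (eq_pick (Q := fun i => coef z i != 0)); last first.
  by move=> i; rewrite coef_lift1.
by case: pickP => // i _; rewrite coef_lift1.
Qed.

End BorsukUlam.

Lemma small_power (R : realType) (q e : R) : 0 <= q < 1 -> 0 < e ->
  exists m, q ^+ m < e.
Proof.
move=> /andP[q0 q1] e0; have : (q ^+ k @[k --> \oo] --> (0 : R))%classic.
  by apply: cvg_expr; rewrite ger0_norm.
move/cvgrPdist_lt => /(_ _ e0)[m _ H]; exists m.
by have := H m (leqnn m); rewrite sub0r normrN ger0_norm // exprn_ge0.
Qed.

(** If there were no common zero, then by compactness some [d] would be such that
    within distance [d] of any point one of the functions keeps its sign; this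
    contradicts [exists_alternating] on simplices of diameter less than [d]. *)
Theorem twisted_borsuk_ulam (R : realType) (m : nat)
    (u : 'rV[R]_(1 + m.+1) -> R) (w : 'I_m -> 'rV[R]_(1 + m.+1) -> R) :
    continuous u -> (forall i, continuous (w i)) ->
    (forall z, u (antipode z) = - u z) ->
    (forall i z, w i (antipode z) = - w i z) ->
    (forall z, u (lift1 z) = - u z) -> (forall i z, w i (lift1 z) = w i z) ->
  exists z, [/\ on_cylinder z, u z = 0 & forall i, w i z = 0].
Proof.
move=> uc wc uo wo ut wp; pose f o := if o is Some i then w i else u.
have fc o : continuous (f o) by case: o.
have fo o z : f o (antipode z) = - f o z by case: o => [i|]; [apply: wo|apply: uo].
apply: contrapT => N.
have f_neq0 z : on_cylinder z -> exists o, f o z != 0.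
  move=> zc; apply: contrapT => f0; apply: N; exists z.
  have f0' o : f o z = 0.
    by apply/eqP/negP => /negP fz; apply: f0; exists o.
  by split=> // [|i]; [apply: (f0' None)|apply: (f0' (Some i))].
have [d d0 dP] : exists2 d : R, 0 < d & forall z, on_cylinder z ->
    exists o, forall z', `|z - z'| < d -> 0 < f o z * f o z'.
  have /compact_near_coveringP := @compact_cylinder R m.+1.
  move=> /(_ R (0 : R)^'+%classic
    (fun d z => exists o, forall z', `|z - z'| < d -> 0 < f o z * f o z')).
  case=> [z zc|d /= d0 H].
    have [o fz] := f_neq0 z zc.
    have : (\forall z' \near z, 0 < f o z * f o z')%classic.
      have fcz : {for z, continuous (fun z' => f o z * f o z')}.
        by apply: continuousM; [exact: cst_continuous|exact: fc].
      apply: (fcz [set x | 0 < x]%classic).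
      by apply: lt_nbhsr; rewrite -expr2 exprn_even_gt0.
    move=> /nbhs_normP[e /= e0 He].
    exists ([set z' | `|z - z'| < e / 2], [set d | 0 < d < e / 2])%classic.
      split=> /=; first by apply/(nbhs_normP z); exists (e / 2) => //=; rewrite divr_gt0.
      exists (e / 2); rewrite /= ?divr_gt0 // => x /=.
      by rewrite sub0r normrN => xe x0; rewrite x0 (le_lt_trans (ler_norm x)).
    move=> [z1 d1] [/= zz1 /andP[d10 d1e]]; exists o => z2 z12.
    have P1 : 0 < f o z * f o z1.
      by apply: He; rewrite /= (lt_trans zz1) // ltr_pdivrMr // ltr_pMr // ltr1n.
    have P2 : 0 < f o z * f o z2.
      apply: He; rewrite /= -[z - z2](subrKA z1) (le_lt_trans (ler_normD _ _)) //.
      by rewrite [e]splitr ltrD // (lt_trans z12).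
    by move: (mulr_gt0 P1 P2); rewrite mulrACA pmulr_rgt0 // -expr2 exprn_even_gt0.
  exists (d / 2); first by rewrite divr_gt0.
  apply: H => /=; last by rewrite divr_gt0.
  by rewrite sub0r normrN gtr0_norm ?divr_gt0 // ltr_pdivrMr // ltr_pMr // ltr1n.
have [l lP] : exists l, (m.+1%:R / m.+2%:R) ^+ l < d / 2 :> R.
  apply: small_power; last by rewrite divr_gt0.
  by rewrite divr_ge0 ?ler0n //= ltr_pdivrMr ?ltr0n // mul1r ltr_nat.
(* The last summand makes the tie rule of [u] change between heights 0 and 1. *)
pose sg o z := if f o z == 0 then
    (if o is Some _ then tie z else tie z (+) (1 <= height z))
  else 0 < f o z.
have sg_odd o : odd_sign sg o.
  move=> z zc; rewrite /sg fo oppr_eq0; case: eqP => [_|/eqP fz].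
    by case: o => [i|]; rewrite tie_antipode // height_antipode addNb.
  by rewrite oppr_gt0 lt_neqAle fz /= leNgt.
have sg_tw : twisted_sign sg None.
  move=> z hz; rewrite /sg /= ut oppr_eq0; case: eqP => [_|/eqP fz].
    by rewrite tie_lift1 height_lift1 hz add0r lexx ler10 addbT addbF.
  by rewrite oppr_gt0 lt_neqAle fz /= leNgt.
have sg_per i : periodic_sign sg (Some i).
  by move=> z; rewrite /sg /= wp tie_lift1.
have [||y [yc yd yP]] := exists_alternating l (sg_odd None) sg_tw (ii := map Some (enum 'I_m)).
- by move=> _ /mapP[i _ ->]; split.
- by rewrite size_map size_enum_ord.
case: y => [|z y] in yc yd yP *; first exact: (yP None (mem_head _ _)).
have [o oP] := dP z (yc z (mem_head _ _)).
apply: (yP o).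
  by case: o {oP} => [i|]; rewrite inE // map_f // mem_enum.
suff sgz v : v \in z :: y -> sg o v = (0 < f o z).
  by move=> a b /sgz -> /sgz ->.
move=> vy; have : 0 < f o z * f o v.
  apply: oP; apply: le_lt_trans (yd _ _ (mem_head _ _) vy) _.
  by rewrite -ltr_pdivlMr.
rewrite /sg; case: eqP => [->|_]; first by rewrite mulr0 ltxx.
by case: (ltrgtP (f o z) 0) => [fz|fz|->];
  rewrite ?mul0r ?ltxx // ?(nmulr_rgt0 _ fz) ?(pmulr_rgt0 _ fz) // => fv;
  rewrite ltNge ltW.
Qed.

(** * Continuous maps of column vectors *)

Lemma continuous_id (T : topologicalType) : continuous (fun x : T => x).
Proof. by move=> x; exact: cvg_id. Qed.

Lemma continuous_of_dist (K L : numFieldType) (f : K -> L) :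
    (forall x e, 0 < e -> exists2 d, 0 < d &
       forall y, `|x - y| < d -> `|f x - f y| < e) ->
  continuous f.
Proof.
move=> H x A /= /(nbhs_ballP (f x))[e e0 sA]; have [d d0 Hd] := H x e e0.
by apply/nbhs_ballP; exists d => //= y xy; apply/sA/Hd.
Qed.


Section Continuity.
Variables (K : numFieldType) (T : topologicalType).

Lemma continuous_add (f g : T -> K) :
  continuous f -> continuous g -> continuous (fun x => f x + g x).
Proof. by move=> fc gc x; exact: (@continuousD K K^o T f g x (fc x) (gc x)). Qed.

Lemma continuous_mul (f g : T -> K) :
  continuous f -> continuous g -> continuous (fun x => f x * g x).
Proof. by move=> fc gc x; exact: (@continuousM K T f g x (fc x) (gc x)). Qed.

Lemma continuous_mx m n (f : T -> 'M[K]_(m, n)) :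
  (forall i j, continuous (fun x => f x i j)) -> continuous f.
Proof.
move=> fc x A [P PA sPA].
have : (\near x, forall ij : 'I_m * 'I_n, P ij.1 ij.2 (f x ij.1 ij.2))%classic.
  by apply: filter_forall => -[i j]; apply: fc; apply: PA.
by apply: filterS => y H; apply: sPA => i j; apply: (H (i, j)).
Qed.

Lemma continuous_entry m n (f : T -> 'M[K]_(m, n)) i j :
  continuous f -> continuous (fun x => f x i j).
Proof.
move=> fc x; apply: (@continuous_comp _ _ _ f (fun M => M i j)); first exact: fc.
exact: coord_continuous.
Qed.

Lemma continuous_o (U W : topologicalType) (f : T -> U) (g : U -> W) :
  continuous f -> continuous g -> continuous (fun x => g (f x)).
Proof. by move=> fc gc x; apply: continuous_comp; [apply: fc|apply: gc]. Qed.

Lemma continuous_mulmx m n p (f : T -> 'M[K]_(m, n)) (g : T -> 'M[K]_(n, p)) :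
  continuous f -> continuous g -> continuous (fun x => f x *m g x).
Proof.
move=> fc gc; apply: continuous_mx => i j.
rewrite (_ : (fun x => _) = fun x => \sum_k f x i k * g x k j); last first.
  by apply: funext => x; rewrite mxE.
by apply: continuous_sum => k x; apply: continuousM; apply: continuous_entry.
Qed.

Lemma continuous_addmx m n (f g : T -> 'M[K]_(m, n)) :
  continuous f -> continuous g -> continuous (fun x => f x + g x).
Proof. by move=> fc gc x; apply: continuousD; [exact: fc|exact: gc]. Qed.

Lemma continuous_oppmx m n (f : T -> 'M[K]_(m, n)) :
  continuous f -> continuous (fun x => - f x).
Proof. by move=> fc x; apply: continuousN; exact: fc. Qed.

Lemma continuous_cst (U : topologicalType) (c : U) : continuous (fun _ : T => c).
Proof. exact: cst_continuous. Qed.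

End Continuity.

(** * Invariance of dimension and of orientation *)

Section Invariance.
Variable R : realType.

Section Position.
Variable m : nat.
Local Notation V := 'rV[R]_(1 + m.+1).

Definition position (z : V) : 'cV[R]_m.+1 := \col_i coef z i.

Lemma position_antipode z : position (antipode z) = - position z.
Proof. by apply/colP => i; rewrite !mxE coef_antipode. Qed.

Lemma position_lift1 z : position (lift1 z) = position z.
Proof. by apply/colP => i; rewrite !mxE coef_lift1. Qed.

Lemma position_neq0 z : on_cylinder z -> position z <> - position z.
Proof.
case=> _ c1 /colP H; have c0 i : coef z i = 0.
  by move: (H i); rewrite !mxE => /eqP; rewrite -addr_eq0 -mulr2n mulrn_eq0 => /eqP.
by move: c1; rewrite big1 => [/esym/eqP|i _]; rewrite ?oner_eq0 // c0 normr0.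
Qed.

Lemma continuous_position : continuous position.
Proof.
apply: continuous_mx => i j.
rewrite (_ : (fun z => _) = fun z => coef z i); last by apply: funext => z; rewrite mxE.
exact: continuous_coef.
Qed.

End Position.

(** The functions [g i v - g i (- v)] are odd. Completed by zeros, one of which
    serves as the twisted function since it is its own opposite, they have a
    common zero [v] on the sphere. *)
Lemma not_injective_of_few_coordinates p q (g : 'I_q -> 'cV[R]_p -> R) :
    (q < p)%N -> (forall i, continuous (g i)) ->
  exists x y, x <> y /\ forall i, g i x = g i y.
Proof.
case: p g => // m g qm gc.
pose w (j : 'I_m) (z : 'rV[R]_(1 + m.+1)) : R :=
  if (insub (j : nat) : option 'I_q) is Some i then g i (position z) - g i (- position z)
  else 0.
have [||||||z [zc _ wz]] := @twisted_borsuk_ulam R m (fun=> 0) w.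
- exact: continuous_cst.
- move=> j; rewrite /w; case: insubP => [i _ _|_]; last exact: continuous_cst.
  move=> z; apply: continuousB.
    exact: (continuous_o (@continuous_position m) (gc i)).
  exact: (continuous_o (continuous_oppmx (@continuous_position m)) (gc i)).
- by move=> z; rewrite oppr0.
- move=> j z; rewrite /w; case: insubP => [i _ _|_]; last by rewrite oppr0.
  by rewrite position_antipode opprK opprB.
- by move=> z; rewrite oppr0.
- by move=> j z; rewrite /w position_lift1.
exists (position z), (- position z); split; first exact: position_neq0.
move=> i; have im := leq_trans (ltn_ord i) qm : (i < m)%N.
by apply/eqP; rewrite -subr_eq0; have := wz (Ordinal im); rewrite /w /= valK => ->.
Qed.

(** The map [v |-> h (t a + v) - h (t a - v)] is odd and does not vanish for
    nonzero [v]; increasing [t] by one reflects it in the coordinate [i0]. *)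
Lemma no_reflecting_translation n (h : 'cV[R]_n -> 'cV[R]_n) a (b : 'I_n -> R) i0 :
    continuous h -> injective h ->
    (forall x, h (x + a) i0 0 = - h x i0 0 + b i0) ->
    (forall x j, j != i0 -> h (x + a) j 0 = h x j 0 + b j) ->
  False.
Proof.
case: n h a b i0 => [|m] h a b i0 hc hi hr ht; first by case: i0 {hr ht}.
pose P (z : 'rV[R]_(1 + m.+1)) := height z *: a + position z.
pose Q (z : 'rV[R]_(1 + m.+1)) := height z *: a - position z.
have PA z : P (antipode z) = Q z by rewrite /P /Q height_antipode position_antipode.
have QA z : Q (antipode z) = P z by rewrite /P /Q height_antipode position_antipode opprK.
have PL z : P (lift1 z) = P z + a.
  by rewrite /P height_lift1 position_lift1 scalerDl scale1r addrAC.
have QL z : Q (lift1 z) = Q z + a.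
  by rewrite /Q height_lift1 position_lift1 scalerDl scale1r addrAC.
have hac : continuous (fun z : 'rV[R]_(1 + m.+1) => height z *: a).
  apply: continuous_mx => i j.
  rewrite (_ : (fun z => _) = fun z => height z * a i j); last first.
    by apply: funext => z; rewrite mxE.
  by move=> z; apply: continuousM; [exact: continuous_height|exact: cst_continuous].
have Pc : continuous P := continuous_addmx hac (@continuous_position m).
have Qc : continuous Q :=
  continuous_addmx hac (continuous_oppmx (@continuous_position m)).
pose D i z := h (P z) i 0 - h (Q z) i 0.
have Dc i : continuous (D i).
  have c1 : continuous (fun z => h (P z) i 0) by apply/continuous_entry/continuous_o.
  have c2 : continuous (fun z => h (Q z) i 0) by apply/continuous_entry/continuous_o.
  by move=> z; exact: (continuousB (c1 z) (c2 z)).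
have DA i z : D i (antipode z) = - D i z by rewrite /D PA QA opprB.
have [||||||z [zc uz wz]] := @twisted_borsuk_ulam R m (D i0) (fun j => D (lift i0 j)) => //.
- by move=> z; rewrite /D PL QL !hr opprD addrACA subrr addr0 opprD.
- by move=> j z; rewrite /D PL QL !ht ?(eq_sym _ i0) ?neq_lift // opprD addrACA subrr addr0.
have /hi : h (P z) = h (Q z).
  apply/colP => i; apply/eqP; rewrite -subr_eq0; apply/eqP.
  by case: (unliftP i0 i) => [j|] ->; [exact: wz|exact: uz].
rewrite /P /Q => /addrI; exact: position_neq0.
Qed.

(** * The complex plane as a real vector space *)

Local Notation C := (R[i] : numFieldType).

Lemma continuous_Re : continuous (@complex.Re R : C -> R).
Proof.
apply: continuous_of_dist => z e e0; exists (e%:C)%C => [|z' zz'].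
  by rewrite ltcR.
rewrite -ltcR; apply: le_lt_trans zz'.
by rewrite -raddfB; apply: normc_ge_Re.
Qed.

Lemma continuous_Im : continuous (@complex.Im R : C -> R).
Proof.
apply: continuous_of_dist => z e e0; exists (e%:C)%C => [|z' zz'].
  by rewrite ltcR.
rewrite -ltcR; apply: le_lt_trans zz'.
rewrite -raddfB normc_def lecR -[leLHS]sqrtr_sqr ler_wsqrtr //.
by rewrite lerDr sqr_ge0.
Qed.

Lemma continuous_real_complex : continuous ((@real_complex R) : R -> C).
Proof.
apply: continuous_of_dist => x e e0; have eR : e = (complex.Re e)%:C%C.
  by case: e e0 => a b; rewrite ltcE /= => /andP[/eqP -> _].
exists (complex.Re e) => [|x' xx']; first by rewrite -ltcR -eR.
rewrite -rmorphB eR.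
by rewrite normc_def /= expr0n addr0 sqrtr_sqr ltcR.
Qed.

End Invariance.

Definition dimension_invariant (K : numFieldType) :=
  forall p q (h : 'cV[K]_p -> 'cV[K]_q), continuous h -> injective h -> (p <= q)%N.

Lemma dimension_invariant_real (R : realType) : dimension_invariant R.
Proof.
move=> p q h hc hi; rewrite leqNgt; apply/negP => qp.
have [|x [y [xy H]]] := not_injective_of_few_coordinates (g := fun i x => h x i 0) qp.
  by move=> i; apply: continuous_entry.
by apply: xy; apply: hi; apply/colP.
Qed.

(** Real and imaginary parts identify the columns of size [p] over [K] with real
    columns of size [2 p]. *)
Lemma dimension_invariant_plane (R : realType) (K : numFieldType)
    (re im : K -> R) (inc : R -> K) (I : K) :
    continuous re -> continuous im -> continuous inc ->
    (forall a b, re (inc a + I * inc b) = a) ->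
    (forall a b, im (inc a + I * inc b) = b) ->
    (forall z w, re z = re w -> im z = im w -> z = w) ->
  dimension_invariant K.
Proof.
move=> rec imc incc reE imE eqK p q h hc hi; rewrite leqNgt; apply/negP => qp.
pose J (x : 'cV[R]_(p + p)) : 'cV[K]_p :=
  \col_i (inc (x (lshift p i) 0) + I * inc (x (rshift p i) 0)).
have cc k : continuous (fun x : 'cV[R]_(p + p) => inc (x k 0)).
  exact: (continuous_o (@coord_continuous _ _ _ k 0) incc).
have Jc : continuous J.
  apply: continuous_mx => i j.
  rewrite (_ : (fun z => _) = fun x : 'cV[R]_(p + p) =>
    inc (x (lshift p i) 0) + I * inc (x (rshift p i) 0)); last first.
    by apply: funext => z; rewrite mxE.
  have Ic k : continuous (fun x : 'cV[R]_(p + p) => I * inc (x k 0)).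
    by apply: continuous_mul; [exact: cst_continuous|exact: cc].
  by apply: continuous_add; [exact: cc|exact: Ic].
pose g (i : 'I_(q + q)) (x : 'cV[R]_(p + p)) : R :=
  match split i with
  | inl i => re (h (J x) i 0) | inr i => im (h (J x) i 0)
  end.
have [||x [y [xy H]]] := not_injective_of_few_coordinates (g := g).
- by rewrite -addnS leq_add // ltnW.
- move=> i; rewrite /g; case: (split i) => k.
    exact: (continuous_o (continuous_entry (i := k) (j := 0) (continuous_o Jc hc)) rec).
  exact: (continuous_o (continuous_entry (i := k) (j := 0) (continuous_o Jc hc)) imc).
apply: xy; suff /colP JJ : J x = J y.
  apply/colP => k; case: (split_ordP k) => i ->; move: (JJ i); rewrite !mxE.
    by move=> /(congr1 re); rewrite !reE.
  by move=> /(congr1 im); rewrite !imE.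
apply: hi; apply/colP => i; apply: eqK.
  by move: (H (unsplit (inl i))); rewrite /g unsplitK.
by move: (H (unsplit (inr i))); rewrite /g unsplitK.
Qed.

Lemma dimension_invariant_complex (R : realType) :
  dimension_invariant (R[i] : numFieldType).
Proof.
apply: (dimension_invariant_plane (I := 'i%C) (@continuous_Re R)
  (@continuous_Im R) (@continuous_real_complex R)).
- by move=> a b /=; rewrite !(mul0r, mul1r, mulr0, subr0, addr0, oppr0).
- by move=> a b /=; rewrite !(mul0r, mul1r, mulr0, add0r, addr0).
- by move=> [a b] [c d] /= -> ->.
Qed.

(** * Similarity *)

Section Similarity.
Variable F : fieldType.

(** Rectangular base changes avoid casts between equal sizes. *)
Lemma mx_similarP m n (A : 'M[F]_m) (B : 'M[F]_n) :
  mx_similar A B <->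
  exists (P : 'M_(n, m)) (Q : 'M_(m, n)),
    [/\ P *m Q = 1%:M, Q *m P = 1%:M & P *m A = B *m P].
Proof.
split=> [[e]|[P [Q [PQ QP PA]]]].
  case: n / e B => B [P uP /eqP]; rewrite castmx_id conjumx // => PA.
  by exists P, (invmx P); rewrite mulmxV // mulVmx // -PA mulmxKV.
have e : m = n.
  apply/eqP; rewrite eqn_leq.
  have /eqP rQ : row_free Q by apply/row_freeP; exists P.
  have /eqP rP : row_free P by apply/row_freeP; exists Q.
  by move: (rank_leq_col P) (rank_leq_col Q); rewrite rP rQ => -> ->.
exists e; move: B P Q PQ QP PA; case: n / e => B P Q PQ QP PA; exists P.
  by case: (mulmx1_unit PQ).
have uP : P \in unitmx by case: (mulmx1_unit PQ).
by apply/eqP; rewrite castmx_id conjumx // PA mulmxK.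
Qed.

Lemma mx_similar_size m n (A : 'M[F]_m) (B : 'M[F]_n) : mx_similar A B -> m = n.
Proof. by case. Qed.

Lemma mx_similar_refl n (A : 'M[F]_n) : mx_similar A A.
Proof.
by apply/mx_similarP; exists 1%:M, 1%:M; rewrite !mul1mx mulmx1; split.
Qed.

Lemma mx_similar_sym m n (A : 'M[F]_m) (B : 'M[F]_n) :
  mx_similar A B -> mx_similar B A.
Proof.
move=> /mx_similarP[P [Q [PQ QP PA]]]; apply/mx_similarP; exists Q, P; split=> //.
by rewrite -[B]mulmx1 -PQ !mulmxA -(mulmxA Q) -PA mulmxA QP mul1mx.
Qed.

Lemma mx_similar_trans l m n (A : 'M[F]_l) (B : 'M[F]_m) (C : 'M[F]_n) :
  mx_similar A B -> mx_similar B C -> mx_similar A C.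
Proof.
move=> /mx_similarP[P [Q [PQ QP PA]]] /mx_similarP[P' [Q' [PQ' QP' PA']]].
apply/mx_similarP; exists (P' *m P), (Q *m Q'); split.
- by rewrite !mulmxA -(mulmxA P') PQ mulmx1.
- by rewrite !mulmxA -(mulmxA Q) QP' mulmx1.
- by rewrite -mulmxA PA !mulmxA PA'.
Qed.

Lemma dsum_mx_mul m n (A B : 'M[F]_m) (C D : 'M[F]_n) :
  dsum_mx A C *m dsum_mx B D = dsum_mx (A *m B) (C *m D).
Proof. by rewrite /dsum_mx mulmx_block !mulmx0 !mul0mx !addr0 !add0r. Qed.

Lemma mx_similar_dsum m m' n n' (A : 'M[F]_m) (A' : 'M[F]_m') (B : 'M[F]_n)
    (B' : 'M[F]_n') :
  mx_similar A A' -> mx_similar B B' -> mx_similar (dsum_mx A B) (dsum_mx A' B').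
Proof.
move=> /mx_similarP[P [Q [PQ QP PA]]] /mx_similarP[P' [Q' [PQ' QP' PA']]].
apply/mx_similarP; exists (block_mx P 0 0 P'), (block_mx Q 0 0 Q').
rewrite /dsum_mx !mulmx_block !mulmx0 !mul0mx !addr0 !add0r PQ QP PQ' QP' PA PA'.
by rewrite -!scalar_mx_block; split.
Qed.

Lemma dsum_mx_exp m n (A : 'M[F]_m) (B : 'M[F]_n) k :
  dsum_mx A B ^+ k = dsum_mx (A ^+ k) (B ^+ k).
Proof.
elim: k => [|k IH]; first by rewrite !expr0 /dsum_mx [LHS]scalar_mx_block.
by rewrite !exprS IH -!mulmxE dsum_mx_mul.
Qed.

Lemma rank_dsum_mx m n (A : 'M[F]_m) (B : 'M[F]_n) :
  \rank (dsum_mx A B) = (\rank A + \rank B)%N.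
Proof. exact: rank_diag_block_mx. Qed.

Lemma intertwine_exp m n (A : 'M[F]_m) (B : 'M[F]_n) (P : 'M_(n, m)) k :
  P *m A = B *m P -> P *m A ^+ k = B ^+ k *m P.
Proof.
move=> PA; elim: k => [|k IH]; first by rewrite !expr0 mulmx1 mul1mx.
by rewrite !exprS -!mulmxE mulmxA PA -mulmxA IH mulmxA.
Qed.

Lemma mx_similar_rank_exp m n (A : 'M[F]_m) (B : 'M[F]_n) k :
  mx_similar A B -> \rank (A ^+ k) = \rank (B ^+ k).
Proof.
have le m' n' (A' : 'M[F]_m') (B' : 'M[F]_n') :
    mx_similar A' B' -> (\rank (B' ^+ k) <= \rank (A' ^+ k))%N.
  move=> /mx_similarP[P [Q [PQ QP /(intertwine_exp k) PA]]].
  rewrite -[B' ^+ k]mulmx1 -PQ mulmxA -PA.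
  exact: leq_trans (mxrankM_maxl _ _) (mxrankM_maxr _ _).
by move=> AB; apply/eqP; rewrite eqn_leq !le //; apply: mx_similar_sym.
Qed.

(** Complementary invariant subspaces, spanned by the rows of [V] and [W],
    split a matrix. *)
Lemma mx_similar_of_split n p q (A : 'M[F]_n) (V : 'M_(p, n)) (W : 'M_(q, n))
    (X : 'M_p) (Y : 'M_q) :
    row_free V -> row_free W -> (V :&: W)%MS = 0 -> (p + q)%N = n ->
    V *m A = X *m V -> W *m A = Y *m W ->
  mx_similar A (dsum_mx X Y).
Proof.
move=> fV fW VW pq VA WA; pose P := col_mx V W.
have rP : \rank P = (p + q)%N.
  rewrite -addsmxE mxrank_disjoint_sum //.
  by move/eqP: fV => ->; move/eqP: fW => ->.
have /row_freeP[Q PQ] : row_free P by rewrite /row_free rP.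
have /row_fullP[Q' QP'] : row_full P by rewrite /row_full rP pq.
have QQ : Q' = Q by rewrite -[Q']mulmx1 -PQ mulmxA QP' mul1mx.
apply/mx_similarP; exists P, Q; split=> //; first by rewrite -QQ.
by rewrite /P /dsum_mx mul_col_mx mul_block_col !mul0mx addr0 add0r VA WA.
Qed.

(** Fitting decomposition: once the rank of [A ^+ k] is minimal, the image and
    the kernel of [A ^+ k] are complementary. *)
Lemma fitting n (A : 'M[F]_n) :
  exists p q (As : 'M[F]_p) (A0 : 'M[F]_q),
    [/\ As \in unitmx, mx_nilpotent A0 & mx_similar A (dsum_mx As A0)].
Proof.
have ex_rank : exists r, `[< exists k, \rank (A ^+ k) = r >].
  by exists (\rank (A ^+ 0)); apply/asboolP; exists 0%N.
case: (ex_minnP ex_rank) => r /asboolP[k rk] rmin.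
have {}rmin j : (r <= \rank (A ^+ j))%N by apply: rmin; apply/asboolP; exists j.
set B := A ^+ k in rk.
have rB2 : \rank (B *m B) = \rank B.
  apply/eqP; rewrite eqn_leq mxrankM_maxl /= rk.
  by rewrite mulmxE /B -exprD rmin.
have BK0 : (B :&: kermx B)%MS = 0.
  apply/eqP; rewrite -mxrank_eq0.
  by have := mxrank_mul_ker B B; rewrite rB2 => /eqP; rewrite -[X in _ == X]addn0 eqn_add2l.
pose V := row_base B; pose W := row_base (kermx B).
have AB : B *m A = A *m B by rewrite !mulmxE /B -exprS -exprSr.
have /submxP[X VX] : (V *m A <= V)%MS.
  rewrite eq_row_base (eqmxMr _ (eq_row_base _)) AB; exact: submxMl.
have /submxP[Y WY] : (W *m A <= W)%MS.
  rewrite eq_row_base (eqmxMr _ (eq_row_base _)); apply/sub_kermxP.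
  by rewrite -mulmxA -AB mulmxA mulmx_ker mul0mx.
exists _, _, X, Y; split; last first.
- apply: (mx_similar_of_split _ _ _ _ VX WY); rewrite ?row_base_free //.
    apply/eqP; rewrite -submx0 -BK0; apply: capmxS; by rewrite eq_row_base.
  by rewrite mxrank_ker subnKC // rank_leq_row.
- exists k; apply/eqP.
  have : Y ^+ k *m W = 0.
    rewrite -(intertwine_exp k WY); apply/sub_kermxP; by rewrite eq_row_base.
  by rewrite -{1}(mul0mx _ W) => /(row_free_inj (row_base_free _)) ->.
- rewrite -row_free_unit /row_free eqn_leq rank_leq_row /=.
  rewrite -(mxrankMfree X (row_base_free B)) -VX (eqmxMr _ (eq_row_base _)).
  by rewrite rk mulmxE /B -exprSr rmin.
Qed.

End Similarity.

(** * Nilpotent Jordan matrices *)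

Section Jordan.
Variable F : fieldType.

Lemma sum_pick (n : nat) (P : pred 'I_n) (f : 'I_n -> F) (i : 'I_n) :
  P =1 pred1 i -> \sum_j (P j)%:R * f j = f i.
Proof.
move=> Pi; rewrite (bigD1 i) //= Pi /= eqxx mul1r big1 ?addr0 // => j ji.
by rewrite Pi /= (negPf ji) mul0r.
Qed.

Lemma nilJordan_block_exp m j (a b : 'I_m) :
  (nilJordan_block F m ^+ j) a b = (a == (b + j)%N :> nat)%:R.
Proof.
elim: j a b => [|j IH] a b; first by rewrite expr0 mxE addn0.
rewrite exprS -mulmxE mxE addnS; case: (eqVneq (a : nat) (b + j).+1) => ab.
  have bj : (b + j < m)%N by rewrite -ab ltnW.
  rewrite (eq_bigr (fun c => (c == Ordinal bj)%:R * (nilJordan_block F m ^+ j) c b)).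
    by rewrite (sum_pick _ (i := Ordinal bj)) // IH /= eqxx.
  by move=> c _; rewrite mxE ab eqSS eq_sym.
apply: big1 => c _; rewrite mxE IH -natrM mulnb.
by case: eqP => //= ac; case: eqP => // cb; rewrite ac cb eqxx in ab.
Qed.

(** The power identifies the first [m - j] coordinates with the last ones and
    kills the others; [X] and [Y] factor it through these [m - j] coordinates. *)
Lemma rank_nilJordan_block_exp m j : \rank (nilJordan_block F m ^+ j) = (m - j)%N.
Proof.
pose X : 'M[F]_(m, m - j) := \matrix_(a, c) (a == (c + j)%N :> nat)%:R.
pose Y : 'M[F]_(m - j, m) := \matrix_(c, b) (c == b :> nat)%:R.
have widen (c : 'I_(m - j)) : (c + j < m)%N by rewrite addnC -ltn_subRL.
have narrow (c : 'I_(m - j)) : (c < m)%N by apply: leq_ltn_trans (widen c); rewrite leq_addr.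
have XY : nilJordan_block F m ^+ j = X *m Y.
  apply/matrixP => a b; rewrite nilJordan_block_exp mxE.
  case: (eqVneq (a : nat) (b + j)%N) => ab.
    have bj : (b < m - j)%N by rewrite ltn_subRL addnC -ab.
    rewrite (eq_bigr (fun c => (c == Ordinal bj)%:R * 1)) ?(sum_pick _ (i := Ordinal bj)) //.
    by move=> c _; rewrite !mxE -natrM mulnb mulr1 ab eqn_add2r eq_sym andbb.
  rewrite big1 // => c _; rewrite !mxE -natrM mulnb.
  by case: eqP => //= ac; case: eqP => // cb; rewrite ac cb eqxx in ab.
have XX : X^T *m X = 1%:M.
  apply/matrixP => c d; rewrite !mxE.
  rewrite (eq_bigr (fun a => (a == Ordinal (widen c))%:R * (a == (d + j)%N :> nat)%:R)).
    by rewrite (sum_pick _ (i := Ordinal (widen c))) //= eqn_add2r.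
  by move=> a _; rewrite !mxE.
have YY : Y *m Y^T = 1%:M.
  apply/matrixP => c d; rewrite !mxE.
  rewrite (eq_bigr (fun a => (a == Ordinal (narrow c))%:R * (d == a :> nat)%:R)).
    by rewrite (sum_pick _ (i := Ordinal (narrow c))) //= eq_sym.
  by move=> a _; rewrite !mxE [_ == nat_of_ord a]eq_sym.
rewrite XY mxrankMfree; last by apply/row_freeP; exists Y^T.
have /eqP rX : row_free X^T by apply/row_freeP; exists X.
by rewrite -mxrank_tr rX.
Qed.

Lemma rank_nilJordan_exp s j :
  \rank (nilJordan_mx F s ^+ j) = sumn [seq m - j | m <- s]%N.
Proof.
elim: s => [|m s IH] /=; first by apply/eqP; rewrite -leqn0 rank_leq_row.
by rewrite dsum_mx_exp rank_dsum_mx rank_nilJordan_block_exp IH.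
Qed.

(** The difference of the sums for [j] and [j + 1] is the number of entries greater
    than [j], and a second difference is a multiplicity. *)
Lemma perm_eq_of_excess (s t : seq nat) :
    all (leq 1) s -> all (leq 1) t ->
    (forall j, sumn [seq m - j | m <- s]%N = sumn [seq m - j | m <- t]%N) ->
  perm_eq s t.
Proof.
have excess (r : seq nat) j :
    sumn [seq m - j | m <- r]%N = (sumn [seq m - j.+1 | m <- r] + count (ltn j) r)%N.
  elim: r => //= m r ->; rewrite addnACA; congr (_ + _)%N.
  case: ltnP => jm; first by rewrite addn1 subnSK.
  by rewrite addn0 (eqP (leqW jm)); apply/eqP.
have mult (r : seq nat) j :
    count (ltn j) r = (count_mem j.+1 r + count (ltn j.+1) r)%N.
  elim: r => //= m r ->; rewrite addnACA; congr (_ + _)%N.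
  by rewrite leq_eqVlt eq_sym; case: eqP => [->|]; rewrite ?ltnn.
move=> s1 t1 H; have Hc j : count (ltn j) s = count (ltn j) t.
  by apply/eqP; rewrite -(eqn_add2l (sumn [seq m - j.+1 | m <- s]%N)) -excess H excess H.
rewrite /perm_eq; apply/allP => -[|j] _ /=.
  have c0 r : all (leq 1) r -> count_mem 0%N r = 0%N.
    by elim: r => //= m r IH /andP[m1 /IH ->]; rewrite addn0; case: m m1.
  by rewrite !c0.
by rewrite -(eqn_add2r (count (ltn j.+1) s)) -mult !Hc -mult.
Qed.

(** A nilpotent matrix of index [l + 1] has a cyclic invariant subspace of
    dimension [l + 1], spanned by the iterates of a row [v] with
    [v *m M ^+ l *m w != 0]; the rows killed by all [M ^+ j *m w] form an
    invariant complement. *)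
Lemma split_jordan_block n (M : 'M[F]_n) l : M ^+ l.+1 = 0 -> M ^+ l != 0 ->
  exists r (Y : 'M_r), [/\ (l.+1 + r)%N = n, Y ^+ l.+1 = 0
    & mx_similar M (dsum_mx (nilJordan_block F l.+1) Y)].
Proof.
move=> Ml1 Ml0; have [i [j Mij]] : exists i j, (M ^+ l) i j != 0.
  have : ~~ [forall i, forall j, (M ^+ l) i j == 0].
    apply: contra Ml0 => /forallP H; apply/eqP/matrixP => i j.
    by rewrite mxE; apply/eqP; move/forallP: (H i).
  by case/forallPn => i /forallPn[j ?]; exists i, j.
have Mbig k : (l < k)%N -> M ^+ k = 0.
  by move=> lk; rewrite -(subnK lk) exprD Ml1 mulr0.
pose c := ((M ^+ l) i j)^-1.
pose V : 'M[F]_(l.+1, n) := \matrix_(a, b) (M ^+ (l - a)) i b.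
pose W : 'M[F]_(n, l.+1) := \matrix_(a, b) (c * (M ^+ b) a j).
have VWE a b : (V *m W) a b = c * (M ^+ (l - a + b)) i j.
  rewrite exprD -mulmxE !mxE mulr_sumr; apply: eq_bigr => k _.
  by rewrite !mxE mulrCA.
have VWu : V *m W \in unitmx.
  rewrite unitmxE det_trig.
    rewrite big1 ?unitr1 // => a _; rewrite VWE subnK ?mulVf //.
    by rewrite -ltnS.
  apply/is_trig_mxP => a b ab; rewrite VWE Mbig ?mxE ?mulr0 //.
  have al : (a <= l)%N by rewrite -ltnS.
  by rewrite -(ltn_add2r a) addnAC subnK // ltn_add2l.
have Mrow k a : \sum_b (M ^+ k) i b * M b a = (M ^+ k.+1) i a.
  by rewrite exprSr -mulmxE mxE.
have Mcol k a : \sum_b M a b * (M ^+ k) b j = (M ^+ k.+1) a j.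
  by rewrite exprS -mulmxE mxE.
have VM : V *m M = nilJordan_block F l.+1 *m V.
  apply/matrixP => a b; rewrite !mxE.
  under eq_bigr do rewrite mxE.
  rewrite Mrow; case: (posnP a) => a0.
    rewrite a0 subn0 Mbig // mxE big1 // => d _.
    by rewrite mxE a0 mul0r.
  have a1 : (a.-1 < l.+1)%N by rewrite prednK // ltnW.
  rewrite (eq_bigr (fun d => (d == Ordinal a1)%:R * (M ^+ (l - d)) i b)).
    rewrite (sum_pick _ (i := Ordinal a1)) //=; congr ((M ^+ _) i b).
    have : (a < l.+1)%N by [].
    by case: (nat_of_ord a) a0 => // a' _ a'l; rewrite subnSK.
  by move=> d _; rewrite !mxE -{1}(prednK a0) eqSS eq_sym.
have MW : M *m W = W *m nilJordan_block F l.+1.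
  apply/matrixP => a b; rewrite !mxE.
  have -> : \sum_k M a k * W k b = c * (M ^+ b.+1) a j.
    by rewrite -Mcol mulr_sumr; apply: eq_bigr => k _; rewrite mxE mulrCA.
  case: (ltnP b l) => bl.
    rewrite (eq_bigr (fun d => (d == Ordinal (bl : b.+1 < l.+1)%N)%:R * W a d)).
      by rewrite (sum_pick _ (i := Ordinal (bl : b.+1 < l.+1)%N)) // mxE.
    by move=> d _; rewrite [nilJordan_block _ _ _ _]mxE mulrC.
  rewrite Mbig // mxE mulr0 big1 // => d _; rewrite [nilJordan_block _ _ _ _]mxE.
  have -> : (d == b.+1 :> nat) = false by rewrite ltn_eqF // (leq_trans (ltn_ord d)).
  by rewrite mulr0.
pose U := row_base (kermx W).
have /submxP[Y UM] : (U *m M <= U)%MS.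
  rewrite eq_row_base (eqmxMr _ (eq_row_base _)); apply/sub_kermxP.
  by rewrite -mulmxA MW mulmxA mulmx_ker mul0mx.
have fV : row_free V.
  by apply/row_freeP; exists (W *m invmx (V *m W)); rewrite mulmxA mulmxV.
have rW : \rank W = l.+1.
  apply/eqP; rewrite eqn_leq rank_leq_col /=.
  by have := mxrankM_maxr V W; rewrite (mxrank_unit VWu).
have ln : (l.+1 <= n)%N by rewrite -rW rank_leq_row.
exists _, Y; split.
- by rewrite mxrank_ker rW subnKC.
- have : Y ^+ l.+1 *m U = 0 by rewrite -(intertwine_exp _ UM) Ml1 mulmx0.
  by rewrite -{1}(mul0mx _ U) => /(row_free_inj (row_base_free _)) ->.
- apply: (mx_similar_of_split fV (row_base_free _) _ _ VM UM); last first.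
    by rewrite mxrank_ker rW subnKC.
  apply/eqP; rewrite -submx0; set C := (_ :&: _)%MS.
  have /submxP[D CD] : (C <= V)%MS by apply: capmxSl.
  have : C *m W = 0.
    apply/sub_kermxP; apply: submx_trans (capmxSr _ _) _; by rewrite eq_row_base.
  rewrite CD -mulmxA => /(congr1 (mulmxr (invmx (V *m W)))) /=.
  by rewrite mulmxK // mul0mx => ->; rewrite mul0mx.
Qed.

(** Blocks are split off by decreasing size, as the index of the complement does
    not exceed that of the whole; sortedness makes the list of sizes unique. *)
Lemma nilpotent_jordan n (M : 'M[F]_n) k : M ^+ k = 0 ->
  exists s, [/\ sorted geq s, all (geq k) s, all (leq 1) s
    & mx_similar M (nilJordan_mx F s)].
Proof.
have [N] := ubnP n; elim: N n M k => // N IH [|n] M k nN Mk.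
  exists [::]; split=> //; rewrite (_ : M = 0); last by apply/matrixP => -[].
  exact: mx_similar_refl.
have [[|l] /eqP Ml lmin] := ex_minnP (ex_intro (fun k => M ^+ k == 0) k (introT eqP Mk)).
  by move/matrixP: Ml => /(_ 0 0) /eqP; rewrite expr0 !mxE eqxx oner_eq0.
have Ml0 : M ^+ l != 0 by apply/negP => /lmin; rewrite ltnn.
have lk : (l.+1 <= k)%N by apply: lmin; apply/eqP.
have [r [Y [rn Yl MY]]] := split_jordan_block Ml Ml0.
have [|s [s_sorted sl s1 Ys]] := IH r Y l.+1 _ Yl.
  by rewrite -ltnS; apply: leq_trans nN; rewrite ltnS -rn addSn ltnS leq_addl.
exists (l.+1 :: s); split=> //=.
- by rewrite path_sortedE ?sl // => a b c ba cb; apply: leq_trans cb ba.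
- rewrite lk /=; apply: sub_all sl => m ml; exact: leq_trans lk.
- exact: mx_similar_trans MY (mx_similar_dsum (mx_similar_refl _) Ys).
Qed.

(** Both matrices are similar to Jordan matrices, and the ranks determine the
    sizes of the blocks. *)
Lemma nilpotent_similar_of_rank m n (A : 'M[F]_m) (B : 'M[F]_n) :
    mx_nilpotent A -> mx_nilpotent B ->
    (forall j, \rank (A ^+ j) = \rank (B ^+ j)) -> mx_similar A B.
Proof.
move=> [k /nilpotent_jordan[s [ss _ s1 As]]] [k' /nilpotent_jordan[t [ts _ t1 Bt]]] H.
have st : perm_eq s t.
  apply: perm_eq_of_excess => // j.
  by rewrite -!rank_nilJordan_exp -(mx_similar_rank_exp _ As) H (mx_similar_rank_exp _ Bt).
have geq_trans : transitive geq by move=> a b c ba cb; apply: leq_trans cb ba.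
have geq_anti : antisymmetric geq by move=> a b; rewrite andbC => /anti_leq.
move: (sorted_eq geq_trans geq_anti ss ts st) => est; rewrite -est in Bt.
exact: mx_similar_trans As (mx_similar_sym Bt).
Qed.

Lemma nilJordan_similar_perm s t : all (leq 1) s -> all (leq 1) t ->
  mx_similar (nilJordan_mx F s) (nilJordan_mx F t) -> perm_eq s t.
Proof.
move=> s1 t1 st; apply: perm_eq_of_excess => // j.
by rewrite -!rank_nilJordan_exp (mx_similar_rank_exp _ st).
Qed.

Lemma nilJordan_nilpotent s : mx_nilpotent (nilJordan_mx F s).
Proof.
have small k t : (sumn t <= k)%N -> sumn [seq m - k | m <- t]%N = 0%N.
  elim: t => //= m t IH mtk; rewrite IH; last exact: leq_trans (leq_addl _ _) mtk.
  by rewrite addn0; apply/eqP; apply: leq_trans (leq_addr _ _) mtk.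
exists (sumn s); apply/eqP.
by rewrite -mxrank_eq0 rank_nilJordan_exp small.
Qed.

End Jordan.

(** * Gluing conjugacies along a height function *)

Section IntegerIterates.
Variables (T : Type) (f g : T -> T).

Definition iterz (j : int) : T -> T :=
  match j with Posz n => iter n f | Negz n => iter n.+1 g end.

Hypotheses (fK : cancel f g) (gK : cancel g f).

Lemma NegzS n : Negz n.+1 + 1 = Negz n.
Proof. by rewrite !NegzE -[n.+2]addn1 PoszD opprD addrNK. Qed.

Lemma iterzS j x : iterz (j + 1) x = f (iterz j x).
Proof.
by case: j => [n|[|n]]; rewrite ?NegzS /= ?gK ?addn1.
Qed.

Lemma iterzSr j x : iterz (j + 1) x = iterz j (f x).
Proof.
case: j => [n|[|n]].
- by rewrite /= addn1 iterSr.
- by rewrite /= fK.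
- by rewrite NegzS -[RHS]/(iter n.+2 g (f x)) [RHS]iterSr fK.
Qed.

End IntegerIterates.

Lemma iterzK (T : Type) (f g : T -> T) j : cancel f g -> cancel g f ->
  cancel (iterz f g j) (iterz g f j).
Proof.
have itK (a b : T -> T) n : cancel a b -> cancel (iter n a) (iter n b).
  by move=> ab; elim: n => // n IH x; rewrite [iter n.+1 a x]iterS iterSr ab IH.
by move=> fg gf; case: j => n; apply: itK.
Qed.

Section Glue.
Variables (R : realType) (X : topologicalType) (ht : X -> R).
Hypothesis ht_cont : continuous ht.

Record lifting (T T' : X -> X) : Prop := Lifting {
  liftingK : cancel T T';
  liftingVK : cancel T' T;
  lifting_cont : continuous T;
  lifting_contV : continuous T';
  lifting_height : forall x, ht (T x) = ht x + 1
}.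

Section OneSide.
Variables (T1 T1' T2 T2' U : X -> X).
Hypotheses (L1 : lifting T1 T1') (L2 : lifting T2 T2').
Hypotheses (U_cont : continuous U) (htU : forall x, ht (U x) = ht x).
Hypothesis U_low : forall x, ht x <= 0 -> U x = x.
Hypothesis U_high : forall x, 0 <= ht x -> U (T1 x) = T2 x.

Let T1K := liftingK L1.
Let T1VK := liftingVK L1.
Let T2K := liftingK L2.
Let T2VK := liftingVK L2.

(** On the heights of integral part [j], the conjugacy is [U] transported by the
    [j]-th iterates from the fundamental domain [0 <= ht x < 1]. *)
Definition glued x :=
  iterz T2 T2' (Num.floor (ht x)) (U (iterz T1' T1 (Num.floor (ht x)) x)).

Lemma height_inv T T' x : lifting T T' -> ht (T' x) = ht x - 1.
Proof. by move=> L; rewrite -{2}(liftingVK L x) (lifting_height L) addrK. Qed.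

Lemma height_iterz T T' j x : lifting T T' ->
  (ht (iterz T T' j x) = ht x + j%:~R) * (ht (iterz T' T j x) = ht x - j%:~R).
Proof.
move=> L; have up n : ht (iter n T x) = ht x + n%:R.
  by elim: n => [|n IH] /=; rewrite ?addr0 // (lifting_height L) IH -addrA natr1.
have dn n : ht (iter n T' x) = ht x - n%:R.
  by elim: n => [|n IH] /=; rewrite ?subr0 // (height_inv _ L) IH -addrA -opprD natr1.
by case: j => n; rewrite ?NegzE ?mulrNz ?opprK; split; [exact: up|exact: dn|exact: dn|exact: up].
Qed.

Lemma floor_add1 (a : R) : Num.floor (a + 1) = Num.floor a + 1.
Proof.
apply: floor_def; have /andP[h1 h2] := floor_itv a.
by rewrite !intrD lerD2r h1 ltrD2r -intrD.
Qed.

Lemma glued_intertwine x : glued (T1 x) = T2 (glued x).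
Proof.
rewrite /glued (lifting_height L1) floor_add1 iterzS //; congr (T2 (iterz _ _ _ (U _))).
by rewrite iterzSr // T1K.
Qed.

Lemma height_glued x : ht (glued x) = ht x.
Proof. by rewrite /glued (height_iterz _ _ L2) htU (height_iterz _ _ L1) addrNK. Qed.

(** Around height [j] the conjugacy is a single composite of continuous maps: of
    the two factors [U], the inner one cancels with [T1] and [T2'] above height
    [j], and the outer one is trivial below. *)
Definition glued_near j x :=
  iterz T2 T2' j (U (T2' (U (T1 (iterz T1' T1 j x))))).

Lemma glued_nearE j x : j%:~R - 1 < ht x < j%:~R + 1 -> glued x = glued_near j x.
Proof.
move=> /andP[jx xj]; have /andP[fx xf] := floor_itv (ht x).
rewrite /glued; case: (lerP j%:~R (ht x)) => jh.
  have -> : Num.floor (ht x) = j by apply: floor_def; rewrite jh intrD.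
  rewrite /glued_near; set w := iterz T1' T1 j x.
  have hw : ht w = ht x - j%:~R by rewrite (height_iterz _ _ L1).
  by rewrite (U_high (x := w)) ?T2K // hw subr_ge0.
have -> : Num.floor (ht x) = j - 1.
  by apply: floor_def; rewrite addrNK jh intrB ltW.
rewrite /glued_near -[j in RHS](addrNK 1) (iterzS T1K) T1VK.
set w := iterz _ _ _ x.
have hw : ht w = ht x - j%:~R + 1.
  by rewrite (height_iterz _ _ L1) intrB opprB addrA addrAC.
rewrite (U_low (x := T2' _)) ?iterzSr ?T2VK //.
by rewrite (height_inv _ L2) htU hw addrK subr_le0 ltW.
Qed.

Lemma iterz_cont (T T' : X -> X) j : continuous T -> continuous T' -> continuous (iterz T T' j).
Proof.
have itc (f : X -> X) n : continuous f -> continuous (iter n f).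
  move=> fc; elim: n => [|n IH]; first exact: continuous_id.
  exact: continuous_o IH fc.
by move=> Tc T'c; case: j => n; apply: itc.
Qed.

Lemma glued_near_cont j : continuous (glued_near j).
Proof.
have [_ _ T1c T1'c _] := L1; have [_ _ T2c T2'c _] := L2.
apply: (continuous_o _ (iterz_cont (j := j) T2c T2'c)).
apply: (continuous_o _ U_cont); apply: (continuous_o _ T2'c).
apply: (continuous_o _ U_cont); apply: (continuous_o _ T1c).
exact: iterz_cont.
Qed.

Lemma glued_cont : continuous glued.
Proof.
move=> x A; have /andP[fx xf] := floor_itv (ht x); set j := Num.floor (ht x) in fx xf.
have jx : j%:~R - 1 < ht x < j%:~R + 1.
  move: xf; rewrite intrD => ->; rewrite andbT.
  by rewrite (lt_le_trans _ fx) // ltrBlDr ltrDl.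
have Nx : nbhs x [set y | j%:~R - 1 < ht y < j%:~R + 1]%classic.
  apply: (ht_cont (x := x) (t := [set y | j%:~R - 1 < y < j%:~R + 1]%classic)).
  by apply: near_in_itvoo; rewrite in_itv.
rewrite (glued_nearE jx) => GA.
have {}GA : nbhs x (glued_near j @^-1` A)%classic by apply: glued_near_cont.
by apply: filterS (filterI GA Nx) => y [/= yA /glued_nearE ->].
Qed.

End OneSide.

(** Both maps have [0 <= ht x < 1] as a fundamental domain. The map [U] prescribes
    a conjugacy there; the conditions on it below height zero and above height one
    make the translates of [U] under the two maps fit together. *)
Lemma glue T1 T1' T2 T2' U U' :
    lifting T1 T1' -> lifting T2 T2' -> cancel U U' -> cancel U' U ->
    continuous U -> continuous U' -> (forall x, ht (U x) = ht x) ->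
    (forall x, ht x <= 0 -> U x = x) ->
    (forall x, 0 <= ht x -> U (T1 x) = T2 x) ->
  exists H H', [/\ cancel H H', cancel H' H, continuous H, continuous H'
    & forall x, H (T1 x) = T2 (H x)].
Proof.
move=> L1 L2 UK U'K Uc U'c hU Ul Uh.
have hU' x : ht (U' x) = ht x by rewrite -{2}(U'K x) hU.
have Ul' x : ht x <= 0 -> U' x = x by move=> /Ul Ux; rewrite -{1}Ux UK.
have Uh' x : 0 <= ht x -> U' (T2 x) = T1 x by move=> /Uh <-; rewrite UK.
have [T1K T1VK _ _ _] := L1; have [T2K T2VK _ _ _] := L2.
exists (glued T1 T1' T2 T2' U), (glued T2 T2' T1 T1' U'); split.
- move=> x; rewrite {1}/glued (height_glued L1 L2 hU) /glued.
  by rewrite (iterzK _ T2K T2VK) UK (iterzK _ T1VK T1K).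
- move=> x; rewrite {1}/glued (height_glued L2 L1 hU') /glued.
  by rewrite (iterzK _ T1K T1VK) U'K (iterzK _ T2VK T2K).
- exact: glued_cont.
- exact: glued_cont.
- exact: glued_intertwine.
Qed.

End Glue.

(** * Paths of nonsingular matrices *)

Lemma continuous_block (T : topologicalType) (K : numFieldType) m1 m2 n1 n2
    (A : T -> 'M[K]_(m1, n1)) (B : T -> 'M[K]_(m1, n2))
    (C : T -> 'M[K]_(m2, n1)) (D : T -> 'M[K]_(m2, n2)) :
  continuous A -> continuous B -> continuous C -> continuous D ->
  continuous (fun x => block_mx (A x) (B x) (C x) (D x)).
Proof.
move=> Ac Bc Cc Dc; apply: continuous_mx => i j.
case: (split_ordP i) => i' ->; case: (split_ordP j) => j' ->.
- under eq_fun do rewrite block_mxEul; exact: continuous_entry.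
- under eq_fun do rewrite block_mxEur; exact: continuous_entry.
- under eq_fun do rewrite block_mxEdl; exact: continuous_entry.
- under eq_fun do rewrite block_mxEdr; exact: continuous_entry.
Qed.

Lemma continuous_scale (T : topologicalType) (K : numFieldType) m n
    (a : T -> K) (A : T -> 'M[K]_(m, n)) :
  continuous a -> continuous A -> continuous (fun x => a x *: A x).
Proof.
move=> ac Ac; apply: continuous_mx => i j.
under eq_fun do rewrite mxE; exact: continuous_mul ac (continuous_entry Ac).
Qed.

Section Isotopy.
Variables (R : realType) (K : numFieldType) (ramp : R -> K).
Hypothesis ramp_cont : continuous ramp.
Hypothesis ramp0 : forall s, s <= 0 -> ramp s = 0.
Hypothesis ramp1 : forall s, 1 <= s -> ramp s = 1.

(** A path from the identity to [L] among nonsingular matrices, extended by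
    constants outside the unit interval; [N] ensures that the inverses are
    continuous too. *)
Definition isotopic m (L : 'M[K]_m) : Prop :=
  exists M N : R -> 'M[K]_m,
    [/\ continuous M, continuous N, forall s, M s *m N s = 1%:M,
        forall s, s <= 0 -> M s = 1%:M & forall s, 1 <= s -> M s = L].

Lemma isotopic1 m : isotopic (1%:M : 'M[K]_m).
Proof.
exists (fun=> 1%:M), (fun=> 1%:M); split=> //; try exact: continuous_cst.
by move=> s; rewrite mulmx1.
Qed.

Lemma isotopic_mul m (L L' : 'M[K]_m) :
  isotopic L -> isotopic L' -> isotopic (L *m L').
Proof.
move=> [M [N [Mc Nc MN M0 M1]]] [M' [N' [Mc' Nc' MN' M0' M1']]].
exists (fun s => M s *m M' s), (fun s => N' s *m N s); split=> [||s|s s0|s s1].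
- exact: continuous_mulmx.
- exact: continuous_mulmx.
- by rewrite mulmxA -(mulmxA (M s)) MN' mulmx1.
- by rewrite M0 // M0' // mulmx1.
- by rewrite M1 // M1'.
Qed.

Lemma isotopic_block l m (S : 'M[K]_m) :
  isotopic S -> isotopic (block_mx 1%:M 0 0 S : 'M_(l + m)).
Proof.
move=> [M [N [Mc Nc MN M0 M1]]].
exists (fun s => block_mx 1%:M 0 0 (M s)), (fun s => block_mx 1%:M 0 0 (N s)).
split=> [||s|s s0|s s1]; try by apply: continuous_block => //; apply: continuous_cst.
- by rewrite mulmx_block !mulmx0 !mul0mx !addr0 !add0r mulmx1 MN -scalar_mx_block.
- by rewrite M0 // -scalar_mx_block.
- by rewrite M1.
Qed.

Lemma isotopic_lower l m (c : 'M[K]_(m, l)) :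
  isotopic (block_mx 1%:M 0 c 1%:M : 'M_(l + m)).
Proof.
exists (fun s => block_mx 1%:M 0 (ramp s *: c) 1%:M).
exists (fun s => block_mx 1%:M 0 (ramp s *: (- c)) 1%:M).
have cc d : continuous (fun s => ramp s *: d : 'M[K]_(m, l)).
  by apply: continuous_scale => //; apply: continuous_cst.
split=> [||s|s s0|s s1]; try by apply: continuous_block => //; apply: continuous_cst.
- rewrite mulmx_block !mulmx0 !mul0mx !addr0 !add0r !mulmx1 !mul1mx.
  by rewrite scalerN subrr -scalar_mx_block.
- by rewrite ramp0 // scale0r -scalar_mx_block.
- by rewrite ramp1 // scale1r.
Qed.

Lemma isotopic_upper l m (c : 'M[K]_(l, m)) :
  isotopic (block_mx 1%:M c 0 1%:M : 'M_(l + m)).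
Proof.
exists (fun s => block_mx 1%:M (ramp s *: c) 0 1%:M).
exists (fun s => block_mx 1%:M (ramp s *: (- c)) 0 1%:M).
have cc d : continuous (fun s => ramp s *: d : 'M[K]_(l, m)).
  by apply: continuous_scale => //; apply: continuous_cst.
split=> [||s|s s0|s s1]; try by apply: continuous_block => //; apply: continuous_cst.
- rewrite mulmx_block !mulmx0 !mul0mx !addr0 !add0r !mulmx1 !mul1mx.
  by rewrite scalerN addNr -scalar_mx_block.
- by rewrite ramp0 // scale0r -scalar_mx_block.
- by rewrite ramp1 // scale1r.
Qed.

Lemma isotopic_scalar (a : R -> K) d :
    continuous a -> (forall s, a s != 0) ->
    (forall s, s <= 0 -> a s = 1) -> (forall s, 1 <= s -> a s = d) ->
  isotopic (d%:M : 'M[K]_1).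
Proof.
move=> ac a_neq0 a0 a1; exists (fun s => (a s)%:M), (fun s => (a s)^-1%:M).
have cs (f : R -> K) : continuous f -> continuous (fun s => (f s)%:M : 'M[K]_1).
  move=> fc; apply: continuous_mx => i j.
  by rewrite !ord1; under eq_fun do rewrite mxE eqxx mulr1n.
split=> [||s|s s0|s s1].
- exact: cs.
- apply: (cs (fun s => (a s)^-1)) => s; apply: continuousV; [exact: a_neq0|exact: ac].
- by rewrite -scalar_mxM mulfV.
- by rewrite a0.
- by rewrite a1.
Qed.

(** By elimination, a nonsingular matrix is a product of unitriangular factors
    and a dilation of one coordinate, and unitriangular matrices are isotopic
    to the identity. *)
Lemma isotopic_of_det (good : K -> Prop) :
    (forall d, d != 0 -> good d -> isotopic (d%:M : 'M[K]_1)) ->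
  forall m (L : 'M[K]_m), \det L != 0 -> good (\det L) -> isotopic L.
Proof.
move=> gs; case=> [L _ _|m].
  by rewrite (_ : L = 1%:M) ?isotopic1 //; [exact: isotopic1|apply/matrixP => -[]].
elim: m => [|m IH] L dL gL.
  by rewrite [L]mx11_scalar; apply: gs; rewrite -det_mx11.
pose upper r : 'M[K]_(1 + m.+1) := block_mx 1%:M r 0 1%:M.
pose lower c : 'M[K]_(1 + m.+1) := block_mx 1%:M 0 c 1%:M.
have dupper r : \det (upper r) = 1 by rewrite det_ublock !det1 mulr1.
have dlower c : \det (lower c) = 1 by rewrite det_lblock !det1 mulr1.
have upperK r M : upper (- r) *m (upper r *m M) = M.
  rewrite mulmxA mulmx_block !mulmx0 !mul0mx !addr0 !add0r !mulmx1 !mul1mx subrr.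
  by rewrite -scalar_mx_block mul1mx.
have lowerK c M : lower (- c) *m (lower c *m M) = M.
  rewrite mulmxA mulmx_block !mulmx0 !mul0mx !addr0 !add0r !mulmx1 !mul1mx addNr.
  by rewrite -scalar_mx_block mul1mx.
have pivot1 (M : 'M[K]_(1 + m.+1)) : \det M = \det L -> ulsubmx M = 1%:M -> isotopic M.
  move=> dM M1; pose S := drsubmx M - dlsubmx M *m ursubmx M.
  have ME : M = lower (dlsubmx M) *m (block_mx 1%:M 0 0 S *m upper (ursubmx M)).
    rewrite !mulmx_block !mulmx0 !mul0mx !addr0 !add0r !mulmx1 !mul1mx.
    rewrite (addrC (dlsubmx M *m _)) subrK.
    by rewrite -[LHS]submxK M1 addr0.
  have dS : \det S = \det L.
    by rewrite -dM ME !det_mulmx dupper dlower det_lblock det1 !mul1r mulr1.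
  rewrite ME; apply: isotopic_mul; first exact: isotopic_lower.
  apply: isotopic_mul; last exact: isotopic_upper.
  by apply: isotopic_block; apply: IH; rewrite dS.
have column (M : 'M[K]_(1 + m.+1)) : \det M = \det L -> dlsubmx M != 0 -> isotopic M.
  move=> dM /cV0Pn[i ci].
  pose r : 'rV[K]_m.+1 := ((1 - ulsubmx M 0 0) / dlsubmx M i 0) *: delta_mx 0 i.
  rewrite -(upperK _ r M); apply: isotopic_mul; first exact: isotopic_upper.
  apply: pivot1; first by rewrite det_mulmx dupper mul1r.
  rewrite -{1}[M]submxK mulmx_block block_mxKul mul1mx.
  have -> : r *m dlsubmx M = (1 - ulsubmx M 0 0)%:M.
    rewrite /r -scalemxAl -rowE [row _ _]mx11_scalar [row _ _ _ _]mxE.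
    by rewrite scale_scalar_mx divfK.
  by rewrite {1}[ulsubmx M]mx11_scalar -raddfD /= addrC subrK.
suff: forall M : 'M[K]_(1 + m.+1), \det M = \det L -> isotopic M by apply.
move=> M dM; have [c0|] := eqVneq (dlsubmx M) 0; last exact: column.
have a0 : ulsubmx M 0 0 != 0.
  apply: contraNneq dL => a0; rewrite -dM -[M]submxK c0 det_ublock.
  by rewrite det_mx11 a0 mul0r.
rewrite -(lowerK _ (const_mx 1) M); apply: isotopic_mul; first exact: isotopic_lower.
apply: column; first by rewrite det_mulmx dlower mul1r.
rewrite -{1}[M]submxK mulmx_block block_mxKdl c0 mulmx0 addr0.
by apply/cV0Pn; exists 0; rewrite mxE big_ord1 mxE mul1r.
Qed.

End Isotopy.

(** * Topological conjugacy *)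

Section Conjugacy.
Variable K : numFieldType.

(** Two sizes are allowed in order to avoid casts between equal sizes. *)
Definition conjugate m n (f : 'cV[K]_m -> 'cV[K]_m) (g : 'cV[K]_n -> 'cV[K]_n) :=
  exists (h : 'cV[K]_n -> 'cV[K]_m) (h' : 'cV[K]_m -> 'cV[K]_n),
    [/\ cancel h h', cancel h' h, continuous h, continuous h'
      & forall x, h (g x) = f (h x)].

Lemma topologically_conjugateP n (f g : 'cV[K]_n -> 'cV[K]_n) :
  topologically_conjugate f g <-> conjugate f g.
Proof.
split=> -[h [h' [hK h'K hc h'c hg]]]; exists h, h'; split=> // x.
  by rewrite hg /= h'K.
by rewrite /= -hg hK.
Qed.

Lemma conjugate_refl n (f : 'cV[K]_n -> 'cV[K]_n) : conjugate f f.
Proof. by exists id, id; split=> //; apply: continuous_id. Qed.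

Lemma conjugate_sym m n (f : 'cV[K]_m -> 'cV[K]_m) (g : 'cV[K]_n -> 'cV[K]_n) :
  conjugate f g -> conjugate g f.
Proof.
move=> [h [h' [hK h'K hc h'c hg]]]; exists h', h; split=> // x.
by rewrite -[in LHS](h'K x) -hg hK.
Qed.

Lemma conjugate_trans l m n (f1 : 'cV[K]_l -> 'cV[K]_l)
    (f2 : 'cV[K]_m -> 'cV[K]_m) (f3 : 'cV[K]_n -> 'cV[K]_n) :
  conjugate f1 f2 -> conjugate f2 f3 -> conjugate f1 f3.
Proof.
move=> [h [h' [hK h'K hc h'c hg]]] [k [k' [kK k'K kc k'c kg]]].
exists (h \o k), (k' \o h'); split.
- exact: can_comp.
- exact: can_comp.
- exact: continuous_o kc hc.
- exact: continuous_o h'c k'c.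
- by move=> x /=; rewrite kg hg.
Qed.

Lemma eq_conjugate m n (f f' : 'cV[K]_m -> 'cV[K]_m) (g g' : 'cV[K]_n -> 'cV[K]_n) :
  f =1 f' -> g =1 g' -> conjugate f g -> conjugate f' g'.
Proof. by move=> /funext -> /funext ->. Qed.

Lemma conjugate_fixed_point_free m n (f : 'cV[K]_m -> 'cV[K]_m)
    (g : 'cV[K]_n -> 'cV[K]_n) :
  conjugate f g -> fixed_point_free f -> fixed_point_free g.
Proof.
move=> [h [h' [hK _ _ _ hg]]] ff x gx.
by apply: (ff (h x)); rewrite -hg gx.
Qed.

Section Columns.
Variables (T : topologicalType).

Lemma continuous_col_mx m n (f : T -> 'cV[K]_m) (g : T -> 'cV[K]_n) :
  continuous f -> continuous g -> continuous (fun x => col_mx (f x) (g x)).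
Proof.
move=> fc gc; apply: continuous_mx => i j; case: (split_ordP i) => i' ->.
- under eq_fun do rewrite col_mxEu; exact: continuous_entry.
- under eq_fun do rewrite col_mxEd; exact: continuous_entry.
Qed.

Lemma continuous_usubmx m n (f : T -> 'cV[K]_(m + n)) :
  continuous f -> continuous (fun x => usubmx (f x)).
Proof.
by move=> fc; apply: continuous_mx => i j; under eq_fun do rewrite mxE; apply: continuous_entry.
Qed.

Lemma continuous_dsubmx m n (f : T -> 'cV[K]_(m + n)) :
  continuous f -> continuous (fun x => dsubmx (f x)).
Proof.
by move=> fc; apply: continuous_mx => i j; under eq_fun do rewrite mxE; apply: continuous_entry.
Qed.

Lemma continuous_lmul m n (A : 'M[K]_(m, n)) (f : T -> 'cV[K]_n) :
  continuous f -> continuous (fun x => A *m f x).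
Proof. by move=> fc; apply: continuous_mulmx => //; apply: continuous_cst. Qed.

End Columns.

Lemma conjugate_affine m n (A : 'M[K]_m) (B : 'M[K]_n) P Q b :
    P *m Q = 1%:M -> Q *m P = 1%:M -> P *m A = B *m P ->
  conjugate (affine A b) (affine B (P *m b)).
Proof.
move=> PQ QP PA; exists (mulmx Q), (mulmx P); split.
- by move=> x; rewrite mulmxA PQ mul1mx.
- by move=> x; rewrite mulmxA QP mul1mx.
- exact/continuous_lmul/continuous_id.
- exact/continuous_lmul/continuous_id.
- move=> x; rewrite /affine mulmxDr !mulmxA QP mul1mx; congr (_ *m x + _).
  by rewrite -[LHS]mulmx1 -PQ !mulmxA -(mulmxA Q B) -PA mulmxA QP mul1mx.
Qed.

Lemma mx_similar_conjugate m n (A : 'M[K]_m) (B : 'M[K]_n) b :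
  mx_similar A B -> exists c, conjugate (affine A b) (affine B c).
Proof.
by move=> /mx_similarP[P [Q [PQ QP PA]]]; exists (P *m b); exact: (conjugate_affine _ PQ QP PA).
Qed.

Definition psum m n (f : 'cV[K]_m -> 'cV[K]_m) (g : 'cV[K]_n -> 'cV[K]_n) :
    'cV[K]_(m + n) -> 'cV[K]_(m + n) :=
  fun z => col_mx (f (usubmx z)) (g (dsubmx z)).

Lemma affine_dsum m n (A : 'M[K]_m) (B : 'M[K]_n) c :
  affine (dsum_mx A B) c =1 psum (affine A (usubmx c)) (affine B (dsubmx c)).
Proof.
move=> z; rewrite /affine /psum /dsum_mx -{1}[z]vsubmxK -{1}[c]vsubmxK.
by rewrite mul_block_col !mul0mx addr0 add0r add_col_mx.
Qed.

Lemma conjugate_psum m m' n n' (f : 'cV[K]_m -> 'cV[K]_m)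
    (f' : 'cV[K]_m' -> 'cV[K]_m') (g : 'cV[K]_n -> 'cV[K]_n)
    (g' : 'cV[K]_n' -> 'cV[K]_n') :
  conjugate f f' -> conjugate g g' -> conjugate (psum f g) (psum f' g').
Proof.
move=> [h [h' [hK h'K hc h'c hf]]] [k [k' [kK k'K kc k'c kg]]].
exists (fun z => col_mx (h (usubmx z)) (k (dsubmx z))).
exists (fun z => col_mx (h' (usubmx z)) (k' (dsubmx z))); split.
- by move=> z; rewrite col_mxKu col_mxKd hK kK vsubmxK.
- by move=> z; rewrite col_mxKu col_mxKd h'K k'K vsubmxK.
- apply: continuous_col_mx.
    exact: continuous_o (continuous_usubmx (@continuous_id _)) hc.
  exact: continuous_o (continuous_dsubmx (@continuous_id _)) kc.
- apply: continuous_col_mx.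
    exact: continuous_o (continuous_usubmx (@continuous_id _)) h'c.
  exact: continuous_o (continuous_dsubmx (@continuous_id _)) k'c.
- by move=> z; rewrite /psum !col_mxKu !col_mxKd hf kg.
Qed.

(** An affine map with nilpotent linear part has a fixed point. *)
Lemma conjugate_nilpotent n (A : 'M[K]_n) b :
  mx_nilpotent A -> conjugate (affine A b) (mulmx A).
Proof.
move=> [k Ak]; pose x0 := (\sum_(i < k) A ^+ i) *m b.
have x0E : A *m x0 + b = x0.
  have : (A - 1) * (\sum_(i < k) A ^+ i) = - 1.
    by rewrite -subrX1 Ak sub0r.
  rewrite mulrBl mul1r => /eqP; rewrite subr_eq addrC => /eqP e.
  by rewrite /x0 mulmxA mulmxE e mulmxBl mul1mx subrK.
exists (fun y => y + x0), (fun y => y - x0); split.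
- exact: addrK.
- exact: subrK.
- by apply: continuous_addmx; [exact: continuous_id|exact: continuous_cst].
- by apply: continuous_addmx; [exact: continuous_id|exact: continuous_cst].
- by move=> y; rewrite /affine mulmxDr -addrA x0E.
Qed.

(** The nilpotent summand of an affine map has a fixed point, so that only the
    nonsingular summand needs a translation part. *)
Lemma conjugate_split n p q (A : 'M[K]_n) (As : 'M[K]_p) (A0 : 'M[K]_q) b :
    mx_nilpotent A0 -> mx_similar A (dsum_mx As A0) ->
    fixed_point_free (affine A b) ->
  exists b1, conjugate (affine A b) (psum (affine As b1) (mulmx A0)) /\
             fixed_point_free (affine As b1).
Proof.
move=> A0n AE ff; have [c cA] := mx_similar_conjugate b AE.
have cA' : conjugate (affine A b) (psum (affine As (usubmx c)) (mulmx A0)).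
  apply: conjugate_trans cA _.
  apply: (eq_conjugate (fun z => esym (affine_dsum As A0 c z)) (fun=> erefl)).
  by apply: conjugate_psum; [exact: conjugate_refl|exact: conjugate_nilpotent].
exists (usubmx c); split=> // x xE.
apply: (conjugate_fixed_point_free cA' ff (x := col_mx x 0)).
by rewrite /psum col_mxKu col_mxKd xE mulmx0.
Qed.

(** * Adapted coordinates of a fixed-point-free affine map *)

(** A map without fixed points admits a linear form that it increases by one:
    [b] is not in the image of [1 - A], so some linear form vanishes on that
    image but not on [b]. *)
Lemma exists_raised_form n (A : 'M[K]_n) b :
  fixed_point_free (affine A b) ->
  exists phi : 'rV[K]_n, phi *m A = phi /\ phi *m b = 1%:M.
Proof.
move=> ff; pose M := (1%:M - A)^T.
have : ~~ (b^T <= M)%MS.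
  apply/negP => /submxP[x bx]; apply: (ff x^T).
  have : b = (1%:M - A) *m x^T by rewrite -[b]trmxK bx trmx_mul trmxK.
  by rewrite /affine mulmxBl mul1mx => ->; rewrite addrC subrK.
rewrite submxE => /rV0Pn[j bj].
pose psi := (col j (cokermx M))^T.
have psiM : psi *m (1%:M - A) = 0.
  by rewrite -[1%:M - A]trmxK -trmx_mul colE mulmxA mulmx_coker mul0mx trmx0.
have psib : psi *m b = ((b^T *m cokermx M) 0 j)%:M.
  rewrite [LHS]mx11_scalar; congr (_%:M); rewrite !mxE.
  by apply: eq_bigr => i _; rewrite !mxE mulrC.
exists (((b^T *m cokermx M) 0 j)^-1 *: psi); split; last first.
  by rewrite -scalemxAl psib scale_scalar_mx mulVf.
move: psiM; rewrite mulmxBr mulmx1 => /subr0_eq psiA.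
by rewrite -scalemxAl -psiA.
Qed.

(** The raised form is taken as first coordinate. *)
Lemma adapted_coordinates m (A : 'M[K]_(1 + m)) b :
  fixed_point_free (affine A b) ->
  exists P c B d, [/\ P \in unitmx, P *m A = block_mx 1%:M 0 c B *m P
    & P *m b = col_mx 1%:M d].
Proof.
move=> /exists_raised_form[phi [phiA phib]].
pose U : 'rV[K]_(1 + m) := row_mx 1%:M 0.
have Uf : U *m col_mx phi 0 = phi by rewrite mul_row_col mul1mx mul0mx addr0.
have phi0 : phi != 0.
  by apply: contra_eq_neq phib => ->; rewrite mul0mx eq_sym matrix_nonzero1.
have rU : \rank U = 1%N.
  rewrite rank_rV; case: eqP => // /(congr1 lsubmx); rewrite row_mxKl.
  by move/eqP; rewrite linear0 (negPf (matrix_nonzero1 _ _)).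
have [|P Pu] := @complete_unitmx _ _ _ U (col_mx phi 0).
  by rewrite Uf rU rank_rV phi0.
rewrite Uf => phiP; have UE M : usubmx M = U *m M :> 'rV[K]_(1 + m).
  by rewrite -{2}[M]vsubmxK mul_row_col mul1mx mul0mx addr0.
pose Z := P *m A *m invmx P.
have uZ : usubmx Z = row_mx 1%:M 0.
  by rewrite UE !mulmxA -phiP phiA phiP mulmxK.
exists P, (dlsubmx Z), (drsubmx Z), (dsubmx (P *m b)); split=> //.
  have -> : block_mx 1%:M 0 (dlsubmx Z) (drsubmx Z) = Z.
    by rewrite /block_mx hsubmxK -uZ vsubmxK.
  by rewrite mulmxKV.
rewrite -[LHS]vsubmxK; congr col_mx.
have -> : usubmx (P *m b) = U *m (P *m b).
  by rewrite -{2}[P *m b]vsubmxK mul_row_col mul1mx mul0mx addr0.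
by rewrite mulmxA -phiP.
Qed.

End Conjugacy.

(** * Construction of conjugacies *)

Section Sufficiency.
Variables (R : realType) (K : numFieldType) (ramp : R -> K) (rise : K -> R).
Hypothesis ramp_cont : continuous ramp.
Hypothesis ramp0 : forall s, s <= 0 -> ramp s = 0.
Hypothesis ramp1 : forall s, 1 <= s -> ramp s = 1.
Hypothesis rise_cont : continuous rise.
Hypothesis rise1 : forall t, rise (t + 1) = rise t + 1.

Section Shift.
Variable m : nat.
Implicit Types (B : 'M[K]_m) (c d : 'cV[K]_m).

Definition shift c B d (z : 'cV[K]_(1 + m)) : 'cV[K]_(1 + m) :=
  col_mx (usubmx z + 1%:M) (B *m dsubmx z + (c *m usubmx z + d)).

Definition unshift c B d (z : 'cV[K]_(1 + m)) : 'cV[K]_(1 + m) :=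
  let t := usubmx z - 1%:M in
  col_mx t (invmx B *m (dsubmx z - (c *m t + d))).

Definition ht (z : 'cV[K]_(1 + m)) : R := rise (usubmx z 0 0).

Lemma affine_shift c B d :
  affine (block_mx 1%:M 0 c B) (col_mx 1%:M d) =1 shift c B d.
Proof.
move=> z; rewrite /affine /shift -{1}[z]vsubmxK mul_block_col add_col_mx.
by rewrite mul1mx mul0mx addr0 -addrA [X in col_mx _ X]addrCA.
Qed.

Lemma ht_cont : continuous ht.
Proof.
have c1 : continuous (fun z : 'cV[K]_(1 + m) => usubmx z 0 0).
  exact: continuous_entry (continuous_usubmx (@continuous_id _)).
exact: continuous_o c1 rise_cont.
Qed.

Lemma lifting_shift c B d :
  B \in unitmx -> lifting ht (shift c B d) (unshift c B d).
Proof.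
move=> uB; have uc : continuous (fun z : 'cV[K]_(1 + m) => usubmx z).
  exact/continuous_usubmx/continuous_id.
have dc : continuous (fun z : 'cV[K]_(1 + m) => dsubmx z).
  exact/continuous_dsubmx/continuous_id.
have tc : continuous (fun z : 'cV[K]_(1 + m) => usubmx z - 1%:M).
  exact: continuous_addmx uc (@continuous_cst _ _ _).
split=> [z|z|||z].
- by rewrite /unshift /shift col_mxKu col_mxKd !addrK mulKmx // vsubmxK.
- by rewrite /unshift /shift col_mxKu col_mxKd mulKVmx // !subrK vsubmxK.
- apply: continuous_col_mx.
    exact: continuous_addmx uc (@continuous_cst _ _ _).
  apply: continuous_addmx; first exact: continuous_lmul dc.
  exact: continuous_addmx (continuous_lmul uc) (@continuous_cst _ _ _).
- apply: (continuous_col_mx tc); apply: continuous_lmul.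
  apply: (continuous_addmx dc); apply: continuous_oppmx.
  exact: continuous_addmx (continuous_lmul tc) (@continuous_cst _ _ _).
- by rewrite /ht /shift col_mxKu mxE [X in rise (_ + X)]mxE eqxx mulr1n rise1.
Qed.

(** Above height one, the gluing map below equals the second shift composed with
    the inverse of the first; as the height decreases to zero, its linear part
    follows an isotopy, and its translation part is scaled down, to the identity. *)
Lemma conjugate_shift c1 B1 d1 c2 B2 d2 :
    B1 \in unitmx -> B2 \in unitmx -> isotopic R (B2 *m invmx B1) ->
  conjugate (shift c2 B2 d2) (shift c1 B1 d1).
Proof.
move=> u1 u2 [M [N [Mc Nc MN M0 M1]]]; set L := B2 *m invmx B1 in M1.
have NM s : N s *m M s = 1%:M by apply: mulmx1C.
pose e (t : 'M[K]_1) : 'cV[K]_m :=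
  (c2 *m (t - 1%:M) + d2) - L *m (c1 *m (t - 1%:M) + d1).
pose V z := col_mx (usubmx z) (M (ht z) *m dsubmx z + ramp (ht z) *: e (usubmx z)).
pose V' z := col_mx (usubmx z) (N (ht z) *m (dsubmx z - ramp (ht z) *: e (usubmx z))).
have uc : continuous (fun z : 'cV[K]_(1 + m) => usubmx z).
  exact/continuous_usubmx/continuous_id.
have dc : continuous (fun z : 'cV[K]_(1 + m) => dsubmx z).
  exact/continuous_dsubmx/continuous_id.
have rc : continuous (fun z => ramp (ht z)) by exact: continuous_o ht_cont ramp_cont.
have ec : continuous (fun z : 'cV[K]_(1 + m) => e (usubmx z)).
  have tc : continuous (fun z : 'cV[K]_(1 + m) => usubmx z - 1%:M).
    exact: continuous_addmx uc (@continuous_cst _ _ _).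
  have lc c d : continuous (fun z : 'cV[K]_(1 + m) => c *m (usubmx z - 1%:M) + d).
    exact: continuous_addmx (continuous_lmul tc) (@continuous_cst _ _ _).
  exact: continuous_addmx (lc _ _) (continuous_oppmx (continuous_lmul (lc _ _))).
have rec : continuous (fun z => ramp (ht z) *: e (usubmx z)) by exact: continuous_scale rc ec.
have Vc : continuous V.
  apply: (continuous_col_mx uc); apply: (continuous_addmx _ rec).
  exact: continuous_mulmx (continuous_o ht_cont Mc) dc.
have Vc' : continuous V'.
  apply: (continuous_col_mx uc); apply: continuous_mulmx.
    exact: continuous_o ht_cont Nc.
  exact: continuous_addmx dc (continuous_oppmx rec).
have htV z : ht (V z) = ht z by rewrite /ht /V col_mxKu.
have htV' z : ht (V' z) = ht z by rewrite /ht /V' col_mxKu.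
have VK : cancel V V'.
  move=> z; rewrite {1}/V' htV /V col_mxKu col_mxKd addrK mulmxA NM mul1mx.
  by rewrite vsubmxK.
have V'K : cancel V' V.
  move=> z; rewrite {1}/V htV' /V' col_mxKu col_mxKd mulmxA MN mul1mx subrK.
  by rewrite vsubmxK.
have V0 z : ht z <= 0 -> V z = z.
  by move=> z0; rewrite /V M0 // ramp0 // scale0r addr0 mul1mx vsubmxK.
have V1 z : 0 <= ht z -> V (shift c1 B1 d1 z) = shift c2 B2 d2 z.
  move=> z0; have h1 : 1 <= ht (shift c1 B1 d1 z).
    by rewrite (lifting_height (lifting_shift _ _ u1)) lerDr.
  rewrite /V M1 // ramp1 // scale1r /shift !col_mxKu col_mxKd /e addrK.
  by rewrite mulmxDr mulmxA {1}/L mulmxKV // -addrA [L *m _ + _]addrC subrK.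
have [H [H' [HK H'K Hc H'c HT]]] := glue ht_cont (lifting_shift c1 d1 u1)
  (lifting_shift c2 d2 u2) VK V'K Vc Vc' htV V0 V1.
by exists H, H'; split.
Qed.

End Shift.

Variable good : K -> Prop.
Hypothesis good_isotopic :
  forall d, d != 0 -> good d -> isotopic R (d%:M : 'M[K]_1).

Lemma conjugate_of_det n (A C : 'M[K]_n) b d :
    fixed_point_free (affine A b) -> fixed_point_free (affine C d) ->
    A \in unitmx -> C \in unitmx -> good (\det A / \det C) ->
  conjugate (affine A b) (affine C d).
Proof.
case: n A C b d => [|m] A C b d fA fC uA uC g.
  by case: (fA 0); apply/colP => -[].
have norm (M : 'M[K]_(1 + m)) v : fixed_point_free (affine M v) -> M \in unitmx ->
    exists (c : 'cV_m) (B : 'M_m) (w : 'cV_m),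
      [/\ B \in unitmx, \det B = \det M & conjugate (affine M v) (shift c B w)].
  move=> /adapted_coordinates[P [c [B [w [uP PM Pv]]]]] uM.
  have dB : \det B = \det M.
    have := congr1 determinant PM; rewrite !det_mulmx det_lblock det1 mul1r mulrC.
    by move=> /mulIf -> //; rewrite -unitfE -unitmxE.
  exists c, B, w; split=> //; first by rewrite unitmxE dB -unitmxE.
  apply: (eq_conjugate (fun=> erefl) (affine_shift c B w)).
  by rewrite -Pv; apply: conjugate_affine PM; [exact: mulmxV|exact: mulVmx].
have [c1 [B1 [w1 [u1 dB1 s1]]]] := norm _ _ fA uA.
have [c2 [B2 [w2 [u2 dB2 s2]]]] := norm _ _ fC uC.
apply: conjugate_trans s1 _; apply: conjugate_trans (conjugate_sym s2).
have nz : \det (B1 *m invmx B2) != 0.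
  by rewrite -unitfE -unitmxE unitmx_mul u1 unitmx_inv.
apply: conjugate_shift => //; apply: (isotopic_of_det ramp_cont ramp0 ramp1 good_isotopic nz).
by rewrite det_mulmx det_inv dB1 dB2.
Qed.

End Sufficiency.

(** * Invariants of topological conjugacy *)

Section Necessity.
Variable K : numFieldType.
Hypothesis dimK : dimension_invariant K.

Lemma iter_affine n (A : 'M[K]_n) b j x :
  iter j (affine A b) x = A ^+ j *m x + iter j (affine A b) 0.
Proof.
elim: j => [|j IH]; first by rewrite mul1mx addr0.
by rewrite !iterS {1}IH /affine mulmxDr mulmxA mulmxE -exprS addrA.
Qed.

(** The image of the [j]-th iterate is an affine subspace of dimension
    [\rank (A ^+ j)], and a conjugacy maps it to its counterpart. *)
Lemma conjugate_rank_le m n (A : 'M[K]_m) b (C : 'M[K]_n) d j :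
  conjugate (affine A b) (affine C d) -> (\rank (C ^+ j) <= \rank (A ^+ j))%N.
Proof.
move=> [h [h' [hK _ hc _ hg]]].
have hgj x : h (iter j (affine C d) x) = iter j (affine A b) (h x).
  by elim: j => //= j IH; rewrite hg IH.
have /row_freeP[rC rCK] := row_base_free (C ^+ j).
have /row_fullP[lC lCK] := col_base_full (C ^+ j).
have /row_fullP[lA lAK] := col_base_full (A ^+ j).
set b' := iter j (affine A b) 0; set d' := iter j (affine C d) 0.
have hE u : h (iter j (affine C d) u) = A ^+ j *m h u + b'.
  by rewrite hgj [LHS]iter_affine.
pose phi y := lA *m (h (col_base (C ^+ j) *m y + d') - b').
have inC y : col_base (C ^+ j) *m y + d' = iter j (affine C d) (rC *m y).
  rewrite iter_affine -/d'; congr (_ + _); rewrite -[X in _ = X *m _]mulmx_base.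
  by rewrite -mulmxA (mulmxA (row_base _)) rCK mul1mx.
have lAA : lA *m A ^+ j = row_base (A ^+ j).
  by rewrite -[RHS]mul1mx -lAK -mulmxA mulmx_base.
have AE (u : 'cV_m) : A ^+ j *m u = col_base (A ^+ j) *m (row_base (A ^+ j) *m u).
  by rewrite mulmxA mulmx_base.
have phic : continuous phi.
  apply: continuous_lmul; apply: continuous_addmx; last exact: continuous_cst.
  apply: (continuous_o _ hc); apply: continuous_addmx; last exact: continuous_cst.
  exact/continuous_lmul/continuous_id.
apply: dimK phic _ => y y'; rewrite /phi !inC !hE !addrK.
rewrite ![lA *m (_ *m _)]mulmxA lAA => e.
have : h (iter j (affine C d) (rC *m y)) = h (iter j (affine C d) (rC *m y')).
  by rewrite !hE !AE e.
move=> /(can_inj hK); rewrite -!inC => /addIr /(congr1 (mulmx lC)).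
by rewrite (mulmxA lC (col_base _) y) (mulmxA lC (col_base _) y') lCK !mul1mx.
Qed.

Lemma conjugate_rank m n (A : 'M[K]_m) b (C : 'M[K]_n) d j :
  conjugate (affine A b) (affine C d) -> \rank (A ^+ j) = \rank (C ^+ j).
Proof.
move=> fg; apply/eqP; rewrite eqn_leq (conjugate_rank_le _ fg).
by rewrite (conjugate_rank_le _ (conjugate_sym fg)).
Qed.

Lemma rank_unit_exp n (A : 'M[K]_n) j : A \in unitmx -> \rank (A ^+ j) = n.
Proof.
move=> uA; elim: j => [|j IH]; first by rewrite mxrank1.
by rewrite exprS -mulmxE mxrankMfree ?mxrank_unit // /row_free IH.
Qed.

Lemma conjugate_nilpotent_similar m n p q r s (A : 'M[K]_m) b (C : 'M[K]_n) d
    (As : 'M[K]_p) (A0 : 'M[K]_q) (Cs : 'M[K]_r) (C0 : 'M[K]_s) :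
    As \in unitmx -> Cs \in unitmx -> mx_nilpotent A0 -> mx_nilpotent C0 ->
    mx_similar A (dsum_mx As A0) -> mx_similar C (dsum_mx Cs C0) ->
    conjugate (affine A b) (affine C d) ->
  p = r /\ mx_similar A0 C0.
Proof.
move=> uA uC nA nC sA sC fg.
have rk j : (p + \rank (A0 ^+ j) = r + \rank (C0 ^+ j))%N.
  have := conjugate_rank j fg.
  rewrite (mx_similar_rank_exp _ sA) (mx_similar_rank_exp _ sC).
  by rewrite !dsum_mx_exp !rank_dsum_mx (rank_unit_exp _ uA) (rank_unit_exp _ uC).
have pr : p = r.
  have [k Ak] := nA; have [l Cl] := nC.
  by have := rk (k + l)%N; rewrite !exprD Ak Cl mulr0 mul0r !mxrank0 !addn0.
split=> //; apply: nilpotent_similar_of_rank => // j.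
by have := rk j; rewrite pr => /addnI.
Qed.

(** A conjugacy maps the image of a high iterate, on which the nilpotent part
    vanishes, to its counterpart, hence restricts to the bijective parts. *)
Lemma conjugate_bijective_part p q r s (f : 'cV[K]_p -> 'cV[K]_p)
    (g : 'cV[K]_r -> 'cV[K]_r) (A0 : 'M[K]_q) (C0 : 'M[K]_s) :
    (forall x k, exists y, iter k f y = x) -> (forall x k, exists y, iter k g y = x) ->
    mx_nilpotent A0 -> mx_nilpotent C0 ->
    conjugate (psum f (mulmx A0)) (psum g (mulmx C0)) -> conjugate f g.
Proof.
have half m m' n n' (f1 : 'cV[K]_m -> 'cV[K]_m) (g1 : 'cV[K]_n -> 'cV[K]_n)
    (N : 'M[K]_m') (N' : 'M[K]_n') h :
    (forall x k, exists y, iter k g1 y = x) -> mx_nilpotent N ->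
    (forall x, h (psum g1 (mulmx N') x) = psum f1 (mulmx N) (h x)) ->
    forall x, h (col_mx x 0) = col_mx (usubmx (h (col_mx x 0))) 0.
  move=> gs [k Nk] hg x; rewrite -{1}[h _]vsubmxK; congr col_mx.
  have [y <-] := gs x k.
  have -> : col_mx (iter k g1 y) 0 = iter k (psum g1 (mulmx N')) (col_mx y 0).
    by elim: {gs Nk} k => //= k <-; rewrite /psum col_mxKu col_mxKd mulmx0.
  have -> u : h (iter k (psum g1 (mulmx N')) u) = iter k (psum f1 (mulmx N)) (h u).
    by elim: {gs Nk} k => //= k IH; rewrite hg IH.
  have -> u : dsubmx (iter k (psum f1 (mulmx N)) u) = N ^+ k *m dsubmx u.
    elim: {gs Nk} k => [|k IH]; first by rewrite mul1mx.
    by rewrite iterS /psum col_mxKd IH mulmxA mulmxE exprS.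
  by rewrite Nk mul0mx.
move=> fs gs nA nC [h [h' [hK h'K hc h'c hg]]].
have h'f x : h' (psum f (mulmx A0) x) = psum g (mulmx C0) (h' x).
  by rewrite -[in LHS](h'K x) -hg hK.
have hE := half _ _ _ _ _ _ _ _ _ gs nA hg.
have h'E := half _ _ _ _ _ _ _ _ _ fs nC h'f.
have cc m m' : continuous (fun x : 'cV[K]_m => col_mx x (0 : 'cV[K]_m')).
  by apply: continuous_col_mx; [exact: continuous_id|exact: continuous_cst].
exists (fun x => usubmx (h (col_mx x 0))), (fun x => usubmx (h' (col_mx x 0))).
split.
- by move=> x; rewrite -hE hK col_mxKu.
- by move=> x; rewrite -h'E h'K col_mxKu.
- exact/continuous_usubmx/(continuous_o _ hc)/cc.
- exact/continuous_usubmx/(continuous_o _ h'c)/cc.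
move=> x; have -> : col_mx (g x) 0 = psum g (mulmx C0) (col_mx x 0).
  by rewrite /psum col_mxKu col_mxKd mulmx0.
by rewrite hg /psum col_mxKu.
Qed.

Lemma iter_affine_surj n (A : 'M[K]_n) b x k :
  A \in unitmx -> exists y, iter k (affine A b) y = x.
Proof.
move=> uA; elim: k x => [|k IH] x; first by exists x.
have [y yx] := IH (invmx A *m (x - b)); exists y.
by rewrite iterS yx /affine mulKVmx // subrK.
Qed.

End Necessity.

(** * The criteria over the two fields *)

(** The part of the criterion that depends on the field: [good] is positivity over
    the reals and holds of everything over the complex numbers. *)
Definition conjugate_if (K : numFieldType) (good : K -> Prop) :=
  forall n (A C : 'M[K]_n) b d,
    fixed_point_free (affine A b) -> fixed_point_free (affine C d) ->
    A \in unitmx -> C \in unitmx -> good (\det A / \det C) ->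
  conjugate (affine A b) (affine C d).

Section Ramp.
Variable R : realType.

Definition ramp (s : R) : R := Num.max 0 (Num.min s 1).

Lemma ramp_cont : continuous ramp.
Proof.
move=> s; apply: (@continuous_max R R (fun=> 0) (fun s => Num.min s 1)).
  exact: cst_continuous.
by apply: (@continuous_min R R id (fun=> 1)); [exact: continuous_id|exact: cst_continuous].
Qed.

Lemma ramp0 s : s <= 0 -> ramp s = 0.
Proof. by move=> s0; rewrite /ramp max_l // ge_min s0. Qed.

Lemma ramp1 s : 1 <= s -> ramp s = 1.
Proof. by move=> s1; rewrite /ramp min_r // max_r. Qed.

Lemma ramp_ge0 s : 0 <= ramp s.
Proof. by rewrite le_max lexx. Qed.

Lemma ramp_le1 s : ramp s <= 1.
Proof. by rewrite ge_max ler01 ge_min lexx orbT. Qed.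

Lemma isotopic_real (d : R) : 0 < d -> isotopic R (d%:M : 'M[R]_1).
Proof.
move=> d0; apply: (@isotopic_scalar _ _ (fun s => 1 + ramp s * (d - 1))).
- apply: continuous_add; first exact: continuous_cst.
  by apply: continuous_mul; [exact: ramp_cont|exact: continuous_cst].
- move=> s; rewrite gt_eqF // mulrBr mulr1 addrCA.
  have [->|r0] := eqVneq (ramp s) 0; first by rewrite mul0r add0r subr0.
  by rewrite ltr_wpDr ?subr_ge0 ?ramp_le1 // mulr_gt0 // lt_def r0 ramp_ge0.
- by move=> s s0; rewrite ramp0 // mul0r addr0.
- by move=> s s1; rewrite ramp1 // mul1r addrC subrK.
Qed.

Lemma conjugate_if_real : conjugate_if (fun d : R => 0 < d).
Proof.
exact: (@conjugate_of_det R R ramp id ramp_cont ramp0 ramp1 (@continuous_id _)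
  (fun=> erefl) _ (fun a _ => @isotopic_real a)).
Qed.

Local Notation C := (R[i] : numFieldType).

Lemma ramp_complex_cont : continuous (fun s => (ramp s)%:C%C : C).
Proof. exact: continuous_o ramp_cont (@continuous_real_complex R). Qed.

(** The segment from one to [d] avoids zero unless [d] is a negative real. *)
Lemma isotopic_complex_segment (d : C) : d != 0 -> ~~ (d < 0) -> isotopic R (d%:M : 'M[C]_1).
Proof.
move=> d0 dn; apply: (@isotopic_scalar _ _ (fun s => 1 + (ramp s)%:C%C * (d - 1))).
- apply: continuous_add; first exact: continuous_cst.
  by apply: continuous_mul; [exact: ramp_complex_cont|exact: continuous_cst].
- move=> s; rewrite mulrBr mulr1 addrCA; set r := ramp s.
  have [r0|r0] := eqVneq r 0; first by rewrite r0 mul0r add0r subr0 oner_neq0.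
  apply: contra dn => /eqP e.
  have rC : r%:C%C != 0 :> C by rewrite -(rmorph0 (real_complex R)) (inj_eq (@complexI R)).
  have dE : d = - ((1 - r) / r)%:C%C.
    apply: (mulfI rC); rewrite mulrN -rmorphM mulrCA mulfV // mulr1 rmorphB rmorph1.
    by apply/eqP; rewrite -addr_eq0 e.
  rewrite lt_neqAle d0 dE oppr_le0 -(rmorph0 (real_complex R)) lecR.
  by rewrite divr_ge0 ?ramp_ge0 // subr_ge0 ramp_le1.
- by move=> s s0; rewrite ramp0 // mul0r addr0.
- by move=> s s1; rewrite ramp1 // mul1r addrC subrK.
Qed.

(** One of the two square roots of [d] is not a negative real. *)
Lemma isotopic_complex (d : C) : d != 0 -> isotopic R (d%:M : 'M[C]_1).
Proof.
move=> d0; have [b bn bd] : exists2 b : C, ~~ (b < 0) & b * b = d.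
  have sd : sqrtc d * sqrtc d = d by rewrite -expr2 sqr_sqrtc.
  case: (boolP (sqrtc d < 0)) => [neg|]; last by exists (sqrtc d).
  by exists (- sqrtc d); rewrite ?mulrNN // oppr_lt0 (lt_gtF neg).
have b0 : b != 0 by apply: contraNneq d0 => b0; rewrite -bd b0 mul0r.
by rewrite -bd scalar_mxM; apply: isotopic_mul; apply: isotopic_complex_segment.
Qed.

Lemma conjugate_if_complex : conjugate_if (fun _ : C => True).
Proof.
have r0 s : s <= 0 -> (ramp s)%:C%C = 0 :> C by move=> s0; rewrite ramp0.
have r1 s : 1 <= s -> (ramp s)%:C%C = 1 :> C by move=> s1; rewrite ramp1.
have h1 (t : C) : complex.Re (t + 1) = complex.Re t + 1 by rewrite raddfD.
exact: (@conjugate_of_det R C _ _ ramp_complex_cont r0 r1 (@continuous_Re R) h1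
  _ (fun a a0 _ => isotopic_complex a0)).
Qed.

End Ramp.

Section Assembly.
Variables (K : numFieldType) (good : K -> Prop).
Hypothesis good_conjugate : conjugate_if good.

Lemma mulmx_affine0 n (A : 'M[K]_n) : mulmx A =1 affine A (0 : 'cV_n).
Proof. by move=> x; rewrite /affine addr0. Qed.

Lemma conjugate_of_parts n p q r s (A C : 'M[K]_n) b d (As : 'M[K]_p)
    (A0 : 'M[K]_q) (Cs : 'M[K]_r) (C0 : 'M[K]_s) :
    fixed_point_free (affine A b) -> fixed_point_free (affine C d) ->
    As \in unitmx -> Cs \in unitmx -> mx_nilpotent A0 -> mx_nilpotent C0 ->
    mx_similar A (dsum_mx As A0) -> mx_similar C (dsum_mx Cs C0) ->
    mx_similar A0 C0 -> good (\det As / \det Cs) ->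
  conjugate (affine A b) (affine C d).
Proof.
move=> fA fC uA uC nA nC sA sC AC gd.
have [b1 [cA fA1]] := conjugate_split nA sA fA.
have [d1 [cC fC1]] := conjugate_split nC sC fC.
have pr : p = r.
  have := mx_similar_size sC; rewrite (mx_similar_size sA) (mx_similar_size AC).
  by move/addIn.
move: Cs uC sC gd d1 cC fC1; case: r / pr => Cs uC sC gd d1 cC fC1.
apply: conjugate_trans cA _; apply: conjugate_trans (conjugate_sym cC).
apply: conjugate_psum; first exact: good_conjugate.
apply: (eq_conjugate (fun x => esym (mulmx_affine0 _ x)) (fun x => esym (mulmx_affine0 _ x))).
have /mx_similarP[P [Q [PQ QP PA]]] := AC.
by rewrite -[X in affine C0 X](mulmx0 _ P); exact: conjugate_affine PQ QP PA.
Qed.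

End Assembly.

Section Canonical.
Variable K : numFieldType.

Definition basis0 n : 'cV[K]_n := \col_(i < n) (i == 0%N :> nat)%:R.

Lemma basis0_fixed_point_free k m (D : 'M[K]_m) :
  (0 < k)%N -> fixed_point_free (affine (dsum_mx (1%:M : 'M_k) D) (basis0 (k + m))).
Proof.
move=> k0 x; rewrite affine_dsum => /(congr1 usubmx).
rewrite /psum col_mxKu /affine mul1mx -[RHS]addr0 => /addrI /colP /(_ (Ordinal k0)).
by rewrite !mxE eqxx => /eqP; rewrite oner_eq0.
Qed.

(** The nonsingular part of a canonical matrix. *)
Definition sign_mx k (e : bool) : 'M[K]_(k + e) := dsum_mx 1%:M (-1)%:M.

Lemma det_sign_mx k e : \det (sign_mx k e) = (-1) ^+ e.
Proof. by rewrite /sign_mx /dsum_mx det_lblock det1 mul1r det_scalar. Qed.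

Lemma sign_mx_unit k e : sign_mx k e \in unitmx.
Proof. by rewrite unitmxE det_sign_mx unitrX // unitrN1. Qed.

Lemma mx_similar_castmx m n (A : 'M[K]_m) (E : m = n) : mx_similar (castmx (E, E) A) A.
Proof. by case: n / E; rewrite castmx_id; apply: mx_similar_refl. Qed.

Lemma canonical_mx_split k e s :
  mx_similar (canonical_mx K k e s) (dsum_mx (sign_mx k e) (nilJordan_mx K s)).
Proof.
have := @block_mxA _ k e (sumn s) k e (sumn s)
  1%:M 0 0 0 (-1)%:M 0 0 0 (nilJordan_mx K s).
rewrite /= !row_mx0 !col_mx0 /canonical_mx /sign_mx /dsum_mx => ->.
exact: mx_similar_castmx.
Qed.

Lemma is_canonicalE n k e s (g : 'cV[K]_n -> 'cV[K]_n) : is_canonical k e s g ->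
  exists C, [/\ g =1 affine C (basis0 n), (0 < k)%N, all (leq 1) s,
    fixed_point_free (affine C (basis0 n))
    & mx_similar C (dsum_mx (sign_mx k e) (nilJordan_mx K s))].
Proof.
move=> [k0 s1 [E gE]]; exists (castmx (E, E) (canonical_mx K k e s)).
split=> //; last exact: mx_similar_trans (mx_similar_castmx _ _) (canonical_mx_split _ _ _).
by case: n / E {g gE}; rewrite castmx_id; apply: basis0_fixed_point_free.
Qed.

End Canonical.

Section Real.
Variable R : realType.

(** A map without fixed points has a nonzero invariant form, which splits an
    eigenvalue one off [A]. In dimension one this leaves determinant one, so that
    a negative determinant requires another dimension. *)
Lemma exists_canonical_size p (A : 'M[R]_p) b : fixed_point_free (affine A b) ->
  A \in unitmx -> exists k (e : bool), [/\ (0 < k)%N, (k + e)%N = p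
    & 0 < \det A * (-1) ^+ e].
Proof.
case: p A b => [|m] A b ff uA; first by case: (ff 0); apply/colP => -[].
have dA : \det A != 0 by rewrite -unitfE -unitmxE.
case: (ltrgtP (\det A) 0) => [neg|pos|e0]; last by rewrite e0 eqxx in dA.
  case: m => [|m] in A b ff uA dA neg *.
    have [P [c [B [w [uP PM _]]]]] := @adapted_coordinates R 0 A b ff.
    have := congr1 determinant PM; rewrite !det_mulmx det_lblock det1 mul1r mulrC.
    rewrite [\det B]det_mx00 mul1r -[RHS]mul1r => /mulIf dA1.
    by move: neg; rewrite dA1 ?ltr10 // -unitfE -unitmxE.
  by exists m.+1, true; split; rewrite ?addn1 // expr1 mulrN1 oppr_gt0.
by exists m.+1, false; split; rewrite ?addn0 // expr0 mulr1.
Qed.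

Lemma translation_not_conjugate_reflected k : (0 < k)%N ->
  ~ conjugate (affine (sign_mx R k true) (basis0 R (k + true)))
              (affine 1%:M (basis0 R (k + true))).
Proof.
move=> k0 [h [h' [hK _ hc _ hg]]].
pose i0 : 'I_(k + true) := rshift k (ord0 : 'I_1).
have ht x : h (x + basis0 R _) = affine (sign_mx R k true) (basis0 R _) (h x).
  by rewrite -hg /affine mul1mx.
apply: (@no_reflecting_translation R _ h (basis0 R _) (fun i => basis0 R _ i 0) i0 hc (can_inj hK)).
  move=> x; rewrite ht affine_dsum /psum col_mxEd /affine mul_scalar_mx scaleN1r.
  by rewrite !mxE.
move=> x j; case: (split_ordP j) => l ->; last by rewrite (ord1 l) eqxx.
by move=> _; rewrite ht affine_dsum /psum col_mxEu /affine mul1mx !mxE.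
Qed.

(** Otherwise one of the maps would be conjugate to a translation and the other to
    a translation composed with a reflection. *)
Lemma conjugate_det_gt0 p (A C : 'M[R]_p) b d :
    fixed_point_free (affine A b) -> fixed_point_free (affine C d) ->
    A \in unitmx -> C \in unitmx -> conjugate (affine A b) (affine C d) ->
  0 < \det A * \det C.
Proof.
have half p' (A' C' : 'M[R]_p') b' d' : fixed_point_free (affine A' b') ->
    fixed_point_free (affine C' d') -> A' \in unitmx -> C' \in unitmx ->
    conjugate (affine A' b') (affine C' d') -> 0 < \det A' -> 0 < \det C'.
  move=> fA fC uA uC AC dA; have [k [e [k0 E dC]]] := exists_canonical_size fC uC.
  case: e E dC => E; last by rewrite mulr1.
  move: A' C' b' d' fA fC uA uC AC dA; case: p' / E => A' C' b' d' fA fC uA uC AC dA dC.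
  case: (@translation_not_conjugate_reflected k k0).
  apply: conjugate_trans (conjugate_trans (conjugate_sym AC) _).
    apply: conjugate_if_real => //; [exact: basis0_fixed_point_free|exact: sign_mx_unit|].
    rewrite det_sign_mx expr1 mulN1r oppr_gt0 invr_lt0.
    by move: dC; rewrite expr1 mulrN1 oppr_gt0.
  apply: conjugate_if_real => //; [|exact: unitmx1|by rewrite det1 divr1].
  have -> : 1%:M = dsum_mx 1%:M 1%:M :> 'M[R]_(k + true) by rewrite scalar_mx_block.
  exact: basis0_fixed_point_free.
move=> fA fC uA uC AC.
have dA : \det A != 0 by rewrite -unitfE -unitmxE.
have dC : \det C != 0 by rewrite -unitfE -unitmxE.
rewrite lt_def mulf_neq0 //=.
case: (ltrgtP (\det A) 0) => [An|Ap|A0]; last by rewrite A0 mul0r.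
  rewrite nmulr_rge0 // leNgt; apply/negP => /(half _ _ _ _ _ fC fA uC uA (conjugate_sym AC)).
  by rewrite ltNge ltW.
by rewrite mulr_ge0 // ltW // (half _ _ _ _ _ fA fC uA uC AC).
Qed.

End Real.

(** * Classification *)
Section Parts.
Variable K : numFieldType.

Lemma conjugate_parts n p q s (A C : 'M[K]_n) b d (As : 'M[K]_p)
    (A0 : 'M[K]_q) (Cs : 'M[K]_p) (C0 : 'M[K]_s) :
    fixed_point_free (affine A b) -> fixed_point_free (affine C d) ->
    As \in unitmx -> Cs \in unitmx -> mx_nilpotent A0 -> mx_nilpotent C0 ->
    mx_similar A (dsum_mx As A0) -> mx_similar C (dsum_mx Cs C0) ->
    conjugate (affine A b) (affine C d) ->
  exists b1 d1, [/\ fixed_point_free (affine As b1),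
    fixed_point_free (affine Cs d1) & conjugate (affine As b1) (affine Cs d1)].
Proof.
move=> fA fC uA uC nA nC sA sC AC.
have [b1 [cA fA1]] := conjugate_split nA sA fA.
have [d1 [cC fC1]] := conjugate_split nC sC fC.
exists b1, d1; split=> //.
apply: (conjugate_bijective_part _ _ nA nC); try by move=> x k; apply: iter_affine_surj.
exact: conjugate_trans (conjugate_sym cA) (conjugate_trans AC cC).
Qed.

Lemma unitmx_of_bijective n (A : 'M[K]_n) b : bijective (affine A b) -> A \in unitmx.
Proof.
move=> /bij_inj inj; rewrite -unitmx_tr -row_free_unit; apply: inj_row_free => v vA.
have : affine A b v^T = affine A b 0.
  by rewrite /affine mulmx0 -[A]trmxK -trmx_mul vA trmx0.
by move/inj => /(congr1 trmx); rewrite trmxK trmx0.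
Qed.

Lemma no_nilpotent_part n p q (A : 'M[K]_n) (As : 'M[K]_p) (A0 : 'M[K]_q) :
    A \in unitmx -> mx_nilpotent A0 -> mx_similar A (dsum_mx As A0) -> q = 0%N.
Proof.
move=> uA [k Ak] sA; have := mx_similar_rank_exp k sA.
rewrite dsum_mx_exp rank_dsum_mx Ak mxrank0 addn0 rank_unit_exp //.
rewrite (mx_similar_size sA) => e; have := rank_leq_row (As ^+ k).
by rewrite -e -[leqRHS]addn0 leq_add2l leqn0 => /eqP.
Qed.

End Parts.

Section Classification.
Variable K : numFieldType.
Hypothesis dimK : dimension_invariant K.

Lemma fixed_point_free_gt0 n (A : 'M[K]_n) b :
  fixed_point_free (affine A b) -> (0 < n)%N.
Proof. by case: n A b => // A b ff; case: (ff 0); apply/colP => -[]. Qed.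

Lemma exists_canonical good (good_conjugate : conjugate_if good) n (A : 'M[K]_n) b p q
    (As : 'M[K]_p) (A0 : 'M[K]_q) k (e : bool) :
    fixed_point_free (affine A b) -> As \in unitmx -> mx_nilpotent A0 ->
    mx_similar A (dsum_mx As A0) ->
    (0 < k)%N -> (k + e)%N = p -> good (\det As / (-1) ^+ e) ->
  exists g s, [/\ is_canonical k e s g, topologically_conjugate (affine A b) g
    & bijective (affine A b) -> s = [::]].
Proof.
move=> fA uA nA sA k0 pE gd; have [l Al] := nA.
have [s [_ _ s1 sJ]] := nilpotent_jordan Al.
have E : (k + (e + sumn s))%N = n.
  by rewrite addnA pE -(mx_similar_size sJ) (mx_similar_size sA).
pose g : 'cV[K]_n -> 'cV[K]_n := affine (castmx (E, E) (canonical_mx K k e s)) (basis0 K n).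
have gc : is_canonical k e s g by split=> //; exists E.
exists g, s; split=> //; last first.
  move=> /unitmx_of_bijective uAA; have := no_nilpotent_part uAA nA sA.
  rewrite (mx_similar_size sJ); case: s s1 {sJ E g gc} => //= m s /andP[m1 _] /eqP.
  by rewrite addn_eq0 (gtn_eqF m1).
have [C [gE _ _ fC sC]] := is_canonicalE gc.
apply/topologically_conjugateP; apply: (eq_conjugate (fun=> erefl) (fun x => esym (gE x))).
apply: (conjugate_of_parts good_conjugate fA fC uA (sign_mx_unit _ _ _) nA
  (nilJordan_nilpotent _ _) sA sC sJ).
by rewrite det_sign_mx.
Qed.

(** The sizes and the blocks are compared by ranks; what is left of the conjugacy
    are two maps whose determinants have to be compared. *)
Lemma canonical_unique n k e s (g : 'cV[K]_n -> 'cV[K]_n) k' e' s'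
    (g' : 'cV[K]_n -> 'cV[K]_n) :
    is_canonical k e s g -> is_canonical k' e' s' g' -> conjugate g g' ->
  [/\ (k + e = k' + e')%N, perm_eq s' s
    & exists b (d : 'cV_(k + e)) (C : 'M_(k + e)),
      [/\ fixed_point_free (affine (sign_mx K k e) b), fixed_point_free (affine C d),
          C \in unitmx, \det C = (-1) ^+ e'
        & conjugate (affine (sign_mx K k e) b) (affine C d)]].
Proof.
move=> /is_canonicalE[A [gA _ s1 fA sA]] /is_canonicalE[C [gC _ s1' fC sC]].
move=> /(eq_conjugate gA gC) AC.
have nJ t := nilJordan_nilpotent K t.
have [kk JJ] := conjugate_nilpotent_similar dimK (sign_mx_unit _ _ _)
  (sign_mx_unit _ _ _) (nJ _) (nJ _) sA sC AC.
split=> //; first by apply: nilJordan_similar_perm s1' s1 (mx_similar_sym JJ).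
have dC := det_sign_mx K k' e'; have uC := sign_mx_unit K k' e'.
move: (sign_mx K k' e') uC dC sC; case: (k' + e')%N / kk => C' uC dC sC.
have [b [d [fb fd bd]]] := conjugate_parts fA fC (sign_mx_unit _ _ _) uC (nJ _) (nJ _) sA sC AC.
by exists b, d, C'; split.
Qed.

End Classification.

Unset Implicit Arguments.
Local Open Scope complex_scope.

Theorem theorem3p1 (R : realType) :
  (forall (n : nat) (A C : 'M[R[i]]_n) (b d : 'cV[R[i]]_n)
     (p q r s : nat) (As : 'M[R[i]]_p) (A0 : 'M[R[i]]_q)
     (Cs : 'M[R[i]]_r) (C0 : 'M[R[i]]_s),
     fixed_point_free (affine A b) -> fixed_point_free (affine C d) ->
     As \in unitmx -> Cs \in unitmx -> mx_nilpotent A0 -> mx_nilpotent C0 ->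
     mx_similar A (dsum_mx As A0) -> mx_similar C (dsum_mx Cs C0) ->
     (topologically_conjugate (affine A b) (affine C d) <-> mx_similar A0 C0))
  /\
  (forall (n : nat) (A C : 'M[R]_n) (b d : 'cV[R]_n)
     (p q r s : nat) (As : 'M[R]_p) (A0 : 'M[R]_q)
     (Cs : 'M[R]_r) (C0 : 'M[R]_s),
     fixed_point_free (affine A b) -> fixed_point_free (affine C d) ->
     As \in unitmx -> Cs \in unitmx -> mx_nilpotent A0 -> mx_nilpotent C0 ->
     mx_similar A (dsum_mx As A0) -> mx_similar C (dsum_mx Cs C0) ->
     (topologically_conjugate (affine A b) (affine C d) <->
        0 < \det As * \det Cs /\ mx_similar A0 C0))
  /\
  (forall (n : nat) (A : 'M[R[i]]_n) (b : 'cV[R[i]]_n),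
     fixed_point_free (affine A b) ->
     exists (g : 'cV[R[i]]_n -> 'cV[R[i]]_n) (k : nat) (s : seq nat),
       [/\ is_canonical k false s g,
           topologically_conjugate (affine A b) g,
           bijective (affine A b) -> s = [::]
         & forall (g' : 'cV[R[i]]_n -> 'cV[R[i]]_n) (k' : nat) (s' : seq nat),
             is_canonical k' false s' g' ->
             topologically_conjugate (affine A b) g' ->
             k' = k /\ perm_eq s' s])
  /\
  (forall (n : nat) (A : 'M[R]_n) (b : 'cV[R]_n),
     fixed_point_free (affine A b) ->
     exists (g : 'cV[R]_n -> 'cV[R]_n) (k : nat) (e : bool) (s : seq nat),
       [/\ is_canonical k e s g,
           topologically_conjugate (affine A b) g,
           bijective (affine A b) -> s = [::]
         & forall (g' : 'cV[R]_n -> 'cV[R]_n) (k' : nat) (e' : bool)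
                  (s' : seq nat),
             is_canonical k' e' s' g' ->
             topologically_conjugate (affine A b) g' ->
             [/\ k' = k, e' = e & perm_eq s' s]]).
Proof.
have dimC := @dimension_invariant_complex R; have dimR := @dimension_invariant_real R.
have goodC := @conjugate_if_complex R; have goodR := @conjugate_if_real R.
split; [|split; [|split]].
- move=> n A C b d p q r s As A0 Cs C0 fA fC uA uC nA nC sA sC.
  split=> [/topologically_conjugateP AC|AC].
    by have [] := conjugate_nilpotent_similar dimC uA uC nA nC sA sC AC.
  apply/topologically_conjugateP.
  exact: (conjugate_of_parts goodC fA fC uA uC nA nC sA sC AC).
- move=> n A C b d p q r s As A0 Cs C0 fA fC uA uC nA nC sA sC.
  have dC : \det Cs != 0 by rewrite -unitfE -unitmxE.
  split=> [/topologically_conjugateP AC|[dAC AC]].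
    have [pr AC0] := conjugate_nilpotent_similar dimR uA uC nA nC sA sC AC.
    split=> //; move: Cs uC sC {dC}; case: r / pr => Cs uC sC.
    have [b1 [d1 [fA1 fC1 AC1]]] := conjugate_parts fA fC uA uC nA nC sA sC AC.
    exact: conjugate_det_gt0 fA1 fC1 uA uC AC1.
  apply/topologically_conjugateP.
  apply: (conjugate_of_parts goodR fA fC uA uC nA nC sA sC AC).
  have -> : \det As / \det Cs = \det As * \det Cs / \det Cs ^+ 2.
    by rewrite expr2 invfM mulrA mulfK.
  by rewrite divr_gt0 // exprn_even_gt0.
- move=> n A b fA; have [p [q [As [A0 [uA nA sA]]]]] := fitting A.
  have [b1 [_ fA1]] := conjugate_split nA sA fA.
  have p0 := fixed_point_free_gt0 fA1.
  have [g [s [gc Ag bs]]] := exists_canonical goodC fA uA nA sA p0 (addn0 p : (p + false)%N = p) I.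
  exists g, p, s; split=> // g' k' s' gc' /topologically_conjugateP Ag'.
  move/topologically_conjugateP: Ag => Ag.
  have [kk ss _] := canonical_unique dimC gc gc' (conjugate_trans (conjugate_sym Ag) Ag').
  by split=> //; move: kk; rewrite !addn0.
- move=> n A b fA; have [p [q [As [A0 [uA nA sA]]]]] := fitting A.
  have [b1 [_ fA1]] := conjugate_split nA sA fA.
  have [k [e [k0 pE dA]]] := exists_canonical_size fA1 uA.
  have gd : 0 < \det As / (-1) ^+ e by rewrite invr_sign.
  have [g [s [gc Ag bs]]] := exists_canonical goodR fA uA nA sA k0 pE gd.
  exists g, k, e, s; split=> // g' k' e' s' gc' /topologically_conjugateP Ag'.
  move/topologically_conjugateP: Ag => Ag.
  have [kk ss [c [d [C [fc fd uC dC cd]]]]] :=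
    canonical_unique dimR gc gc' (conjugate_trans (conjugate_sym Ag) Ag').
  have := conjugate_det_gt0 fc fd (sign_mx_unit _ _ _) uC cd.
  have sign_eq (a a' : bool) : 0 < (-1) ^+ (a (+) a') :> R -> a = a'.
    by case: a; case: a' => //=; rewrite expr1 ltr0N1.
  rewrite det_sign_mx dC -signr_addb => /sign_eq ee.
  by split=> //; apply: (@addIn e); rewrite kk ee.
Qed.
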